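(* (Srivastava-Agarwal type bilinear generating function for $\psi_n^{(\mathbf a,\mathbf b)}(x,y|q)$.) Let $|q|<1$. The following bilinear generating function holds true: $$\sum_{n=0}^\infty\psi_n^{(\mathbf a,\mathbf b)}(x,y|q)\,\psi_n^{(\alpha)}(\mu|q)\,(-1)^nq^{\binom n2}\,\frac{t^n}{(q;q)_n}=\frac{(\mu yt,yt;q)_\infty}{(\alpha\mu yt;q)_\infty}\sum_{j=0}^\infty\frac{(a_1,a_2,\dots,a_{r+1};q)_j}{(q,b_1,b_2,\dots,b_r;q)_j}\,(xt)^j\;{}_3\Phi_2\!\left[\begin{matrix}q^{-j},\,q/(yt),\,1/\alpha\\ q/(\alpha\mu yt),\,0\end{matrix};q;q\right]\qquad(|\alpha\mu yt|<1).$$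
   Context: Notation: $(a;q)_0=1$, $(a;q)_n=\prod_{k=0}^{n-1}(1-aq^k)$, $(a;q)_\infty=\prod_{k=0}^\infty(1-aq^k)$, $(c_1,\dots,c_m;q)_n=(c_1;q)_n\cdots(c_m;q)_n$ (also for $n=\infty$), and $\left[{n\atop k}\right]_q=\frac{(q;q)_n}{(q;q)_k(q;q)_{n-k}}$ is the $q$-binomial coefficient. Basic hypergeometric series: ${}_3\Phi_2\!\left[\begin{matrix}\alpha_1,\alpha_2,\alpha_3\\ \beta_1,\beta_2\end{matrix};q;z\right]=\sum_{i\ge0}\frac{(\alpha_1,\alpha_2,\alpha_3;q)_i}{(\beta_1,\beta_2;q)_i}\frac{z^i}{(q;q)_i}$. With parameters $\mathbf a=(a_1,\dots,a_{r+1})$ and $\mathbf b=(b_1,\dots,b_r)$, the generalized Al-Salam-Carlitz $q$-polynomials $\psi_n^{(\mathbf a,\mathbf b)}$ and the Hahn (Al-Salam-Carlitz) polynomials $\psi_n^{(\alpha)}$ are $$\psi_n^{(\mathbf a,\mathbf b)}(x,y|q)=\sum_{k=0}^n\left[{n\atop k}\right]_q\frac{(a_1,\dots,a_{r+1};q)_k}{(b_1,\dots,b_r;q)_k}\,(-1)^kq^{\binom{k+1}2-nk}\,x^ky^{n-k},$$ $$\psi_n^{(\alpha)}(\mu|q)=\sum_{k=0}^nq^{k(k-n)}\left[{n\atop k}\right]_q(\alpha q^{1-k};q)_k\,\mu^k.$$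
   Formalization: The printed claim fails (e.g. r=0, a_1=0, x=y, yt=q). Added: absolute convergence of the left side as a double series once ψ_n^(a,b) is expanded; also q,y,t,α,μ nonzero and (b_i;q)_k, (q/(αμyt);q)_i never zero, so that both sides are defined. *)

(* Defs.v *)
From HB Require Import structures.
From mathcomp Require Import all_boot all_order all_algebra.
From mathcomp Require Import complex.
From mathcomp Require Import all_classical all_reals all_analysis.

Set Implicit Arguments.
Unset Strict Implicit.
Unset Printing Implicit Defensive.

Import Order.TTheory GRing.Theory Num.Theory numFieldNormedType.Exports.
Local Open Scope ring_scope.
Local Open Scope classical_set_scope.

(* The library puts the normed-module structure given by the modulus only on the
   alias R[i]^o; this transports it to R[i], so that limits can be taken there. *)
HB.instance Definition _ (R : realType) := NormedModule.copy R[i] R[i]^o.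

Definition qpoch (K : fieldType) (c q : K) (n : nat) : K :=
  \prod_(k < n) (1 - c * q ^+ k).

Definition qpochs (K : fieldType) (cs : seq K) (q : K) (n : nat) : K :=
  \prod_(c <- cs) qpoch c q n.

Definition qbinom (K : fieldType) (q : K) (n k : nat) : K :=
  qpoch q q n / (qpoch q q k * qpoch q q (n - k)).

(* Meaningful for |q| < 1, where the partial products always converge. *)
Definition qpoch_inf (R : realType) (c q : R[i]) : R[i] :=
  limn (fun n => qpoch c q n).

Definition qpochs_inf (R : realType) (cs : seq R[i]) (q : R[i]) : R[i] :=
  \prod_(c <- cs) qpoch_inf c q.

(* A genuine infinite series. When a1 = q ^- j the terms of index i > j vanish;
   a zero lower parameter contributes the factor (0; q)_i = 1. *)
Definition phi32 (R : realType) (a1 a2 a3 b1 b2 q z : R[i]) : R[i] :=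
  limn (series (fun i =>
    qpochs [:: a1; a2; a3] q i / qpochs [:: b1; b2] q i
    * (z ^+ i / qpoch q q i))).

(* The summand is kept separate from psi so that one can speak of the absolute
   convergence of double series over (n, k). The exponent binom(k+1, 2) - nk may
   be negative, hence the integer power. The lists a and b hold a_1..a_{r+1} and
   b_1..b_r. *)
Definition psi_term (K : fieldType) (a b : seq K) (x y q : K) (n k : nat) : K :=
  qbinom q n k * (qpochs a q k / qpochs b q k)
  * (-1) ^+ k * q ^ ('C(k.+1, 2)%:Z - (n * k)%:Z) * x ^+ k * y ^+ (n - k).

Definition psi (K : fieldType) (a b : seq K) (n : nat) (x y q : K) : K :=
  \sum_(k < n.+1) psi_term a b x y q n k.

Definition hahn_psi (K : fieldType) (alpha : K) (n : nat) (mu q : K) : K :=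
  \sum_(k < n.+1)
    q ^ (k%:Z * (k%:Z - n%:Z)) * qbinom q n k
    * qpoch (alpha * q ^ (1 - k%:Z)) q k * mu ^+ k.

(* Main.v *)
Require Import Defs.
From HB Require Import structures.
From mathcomp Require Import all_boot all_order all_algebra.
From mathcomp Require Import complex.
From mathcomp Require Import all_classical all_reals all_analysis.
From mathcomp Require Import ring zify.

Set Implicit Arguments.
Unset Strict Implicit.
Unset Printing Implicit Defensive.

Import Order.TTheory GRing.Theory Num.Theory numFieldNormedType.Exports.
Local Open Scope ring_scope.
Local Open Scope classical_set_scope.

(** Write z = y t, let h_n be the Hahn polynomials, and let D_k be the factor
    (a)_k / ((q)_k (b)_k) (x t)^k. In the double series over (n, k), put
    n = k + m: all powers of q that couple k and m cancel
    ([psi_term_shifted_term]), and the (n, k) term becomes D_k s_(k,m) with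
    s_(k,m) = (-1)^m q^binom(m,2) z^m h_(k+m) / (q)_m, called [shifted_term].
    Absolute convergence allows the summation over m to be done first
    ([triangular_sum_exchange]), so that everything reduces to the evaluation
    of S_k(z) = sum_m s_(k,m) ([has_sum_hahn_shifted]), namely
    S_k(z) = G(z) Phi_k(z), where G(z) = (mu z, z)_oo / (al mu z)_oo and Phi_k
    is the terminating 3Phi2.

    For k = 0, the numbers e_n = (-1)^n q^binom(n,2) h_n / (q)_n are a Cauchy
    product of two q-hypergeometric sequences, and this gives the functional
    equation (1 - al mu z) E(z) = (1 - mu z) (1 - z) E(q z) for their generating
    function E. Iterating it and letting q^N z tend to 0 identifies E with G at
    every point, other than a pole of G, where E converges absolutely, even
    outside the disc |al mu z| < 1.

    The step from k to k + 1 is q / z (S_k(z) - S_k(z / q)) = S_(k+1)(z), which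
    holds term by term ([shifted_term_diff]). The absolute convergence of
    S_(k+1)(z) implies that of S_k at z and at z / q, and Phi_k satisfies the
    matching contiguous relation ([phi32_sum_rec]).

    The convergence of the series of D_k Phi_k does not follow from this when
    G(z) = 0, as happens for instance when z is a nonpositive power of q. If some
    D_k is 0, the series is finite. Otherwise all S_k(z) converge absolutely, so E
    is entire; the poles of G then have to cancel, which forces al or al mu to
    be q^M for some natural number M ([abs_summable_all_shifts]). If al = q^M,
    then Phi_k = O(q^(-kM)) while q^(kM) h_k has a nonzero limit. The other case
    follows by the symmetry that exchanges al and al mu, mu and 1 / mu, z and
    mu z. Hence Phi_k = O(h_k) in both cases ([phi32_sum_dominated]), and
    D_k h_k is the diagonal term (k, k) of the given absolutely convergent
    double series. *)

(** * Limits of complex sequences *)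

(** The modulus of a complex number is itself an element of R[i]; positive
    elements of R[i] are automatically real, so this is the usual definition. *)
Lemma cvgCP (R : realType) (f : nat -> R[i]) (l : R[i]) :
  f @ \oo --> l <->
  forall e, 0 < e -> exists N, forall n, (N <= n)%N -> `|l - f n| < e.
Proof.
split=> [/(@cvgrPdist_lt R[i] R[i]) h e e0|h].
  by have [N _ hN] := h _ e0; exists N => n hn; apply: hN.
apply/(@cvgrPdist_lt R[i] R[i]) => e e0.
by have [N hN] := h e e0; exists N.
Qed.

Lemma cvgC_unique (R : realType) (f : nat -> R[i]) (l m : R[i]) :
  f @ \oo --> l -> f @ \oo --> m -> l = m.
Proof. by move=> fl fm; rewrite -(cvg_lim _ fl) // (cvg_lim _ fm). Qed.

Lemma cvgC_cst (R : realType) (c : R[i]) : (fun _ : nat => c) @ \oo --> c.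
Proof. exact: cvg_cst. Qed.

Lemma cvgCD (R : realType) (f g : nat -> R[i]) (l m : R[i]) :
  f @ \oo --> l -> g @ \oo --> m -> (fun n => f n + g n) @ \oo --> l + m.
Proof. by move=> fl gm; apply: (@cvgD R[i] R[i]); [exact: fl|exact: gm]. Qed.

Lemma cvgCB (R : realType) (f g : nat -> R[i]) (l m : R[i]) :
  f @ \oo --> l -> g @ \oo --> m -> (fun n => f n - g n) @ \oo --> l - m.
Proof. by move=> fl gm; apply: (@cvgB R[i] R[i]); [exact: fl|exact: gm]. Qed.

Lemma cvgCM (R : realType) (f g : nat -> R[i]) (l m : R[i]) :
  f @ \oo --> l -> g @ \oo --> m -> (fun n => f n * g n) @ \oo --> l * m.
Proof. by move=> fl gm; apply: (@cvgM R[i]); [exact: fl|exact: gm]. Qed.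

Lemma cvgCV (R : realType) (f : nat -> R[i]) (l : R[i]) :
  l != 0 -> f @ \oo --> l -> (fun n => (f n)^-1) @ \oo --> l^-1.
Proof. by move=> l0 fl; apply: (@cvgV R[i]); [exact: l0|exact: fl]. Qed.

Lemma cvgC_bigsum (R : realType) (N : nat) (F : nat -> nat -> R[i])
    (L : nat -> R[i]) :
  (forall k, (k < N)%N -> F k @ \oo --> L k) ->
  (fun n => \sum_(k < N) F k n) @ \oo --> \sum_(k < N) L k.
Proof.
elim: N => [|N IHN] FL.
  rewrite big_ord0; have -> : (fun n => \sum_(k < 0) F k n) = (fun=> 0).
    by apply/funext => n; rewrite big_ord0.
  exact: cvgC_cst.
rewrite big_ord_recr /=.
have -> : (fun n => \sum_(k < N.+1) F k n)
    = (fun n => \sum_(k < N) F k n + F N n).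
  by apply/funext => n; rewrite big_ord_recr.
apply: cvgCD; last exact: FL.
by apply: IHN => k kN; apply: FL; apply: ltnW.
Qed.

Lemma cvgC_addl (R : realType) (N : nat) (f : nat -> R[i]) (l : R[i]) :
  f @ \oo --> l -> (fun n => f (N + n)%N) @ \oo --> l.
Proof.
move=> /cvgCP h; apply/cvgCP => e /h[M hM]; exists M => n Mn.
by apply: hM; rewrite (leq_trans Mn) // leq_addl.
Qed.

Lemma cvgC_shift (R : realType) (N : nat) (f : nat -> R[i]) (l : R[i]) :
  (fun n => f (N + n)%N) @ \oo --> l -> f @ \oo --> l.
Proof.
move=> /cvgCP h; apply/cvgCP => e /h[M hM].
exists (N + M)%N => n hn; have NleN : (N <= n)%N := leq_trans (leq_addr _ _) hn.
by have := hM (n - N)%N; rewrite subnKC //; apply; rewrite leq_subRL.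
Qed.

Lemma norm_limC_le (R : realType) (f : nat -> R[i]) (l B : R[i]) :
  (forall n, `|f n| <= B) -> f @ \oo --> l -> `|l| <= B.
Proof.
move=> fB /cvgCP fl.
have B0 : 0 <= B by apply: le_trans (fB 0%N).
rewrite real_leNgt ?ger0_real //; apply/negP => Bl.
have [N /(_ N (leqnn _)) hN] := fl (`|l| - B) ltac:(by rewrite subr_gt0).
have : `|l| < `|l| - B + B.
  rewrite -{1}(subrK (f N) l); apply: le_lt_trans (ler_normD _ _) _.
  exact: ltr_leD.
by rewrite subrK ltxx.
Qed.

(** * Sums of complex series *)

Definition has_sum (R : realType) (f : nat -> R[i]) (l : R[i]) : Prop :=
  (fun n => \sum_(i < n) f i) @ \oo --> l.

Lemma has_sumP (R : realType) (f : nat -> R[i]) (l : R[i]) :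
  has_sum f l <-> series f @ \oo --> l.
Proof. by rewrite seriesEord. Qed.

Lemma has_sum_unique (R : realType) (f : nat -> R[i]) (l m : R[i]) :
  has_sum f l -> has_sum f m -> l = m.
Proof. exact: cvgC_unique. Qed.

Lemma has_sumZ (R : realType) (c : R[i]) (f : nat -> R[i]) (l : R[i]) :
  has_sum f l -> has_sum (fun n => c * f n) (c * l).
Proof.
move=> fl; rewrite /has_sum; under eq_fun do rewrite -mulr_sumr.
by apply: cvgCM; [exact: cvgC_cst|exact: fl].
Qed.

Lemma has_sumB (R : realType) (f g : nat -> R[i]) (l m : R[i]) :
  has_sum f l -> has_sum g m -> has_sum (fun n => f n - g n) (l - m).
Proof.
move=> fl gm; rewrite /has_sum; under eq_fun do rewrite sumrB.
by apply: cvgCB; [exact: fl|exact: gm].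
Qed.

Lemma has_sumD (R : realType) (f g : nat -> R[i]) (l m : R[i]) :
  has_sum f l -> has_sum g m -> has_sum (fun n => f n + g n) (l + m).
Proof.
move=> fl gm; rewrite /has_sum; under eq_fun do rewrite big_split.
by apply: cvgCD; [exact: fl|exact: gm].
Qed.

(** Allows a finite segment to be split off: it serves both to skip initial
    zeros and to ignore the terms before an estimate starts to hold. *)
Lemma has_sum_tail (R : realType) (f : nat -> R[i]) (l : R[i]) (N : nat) :
  has_sum (fun n => f (N + n)%N) l -> has_sum f (\sum_(i < N) f i + l).
Proof.
move=> fl; apply: (@cvgC_shift _ N).
under eq_fun do rewrite big_split_ord.
by apply: cvgCD; [exact: cvgC_cst|exact: fl].
Qed.

Lemma has_sum_finite (R : realType) (f : nat -> R[i]) (N : nat) :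
  (forall n, (N <= n)%N -> f n = 0) -> has_sum f (\sum_(i < N) f i).
Proof.
move=> f0; rewrite -[X in has_sum _ X]addr0; apply: has_sum_tail.
have -> : (fun n => f (N + n)%N) = (fun=> 0).
  by apply/funext => n; rewrite f0 ?leq_addr.
by rewrite /has_sum; under eq_fun do rewrite big1_eq; exact: cvgC_cst.
Qed.

(** * Absolute summability *)

(** Absolute summability is expressed by a bound on the partial sums, which is
    stable under comparison without any appeal to completeness. *)
Definition abs_summable (R : realType) (f : nat -> R[i]) : Prop :=
  exists B : R[i], forall n, \sum_(i < n) `|f i| <= B.

Lemma abs_summable_le (R : realType) (C : R[i]) (f g : nat -> R[i]) :
  0 <= C -> (forall n, `|f n| <= C * `|g n|) ->
  abs_summable g -> abs_summable f.
Proof.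
move=> C0 fg [B gB]; exists (C * B) => n.
apply: (@le_trans _ _ (\sum_(i < n) C * `|g i|)); first exact: ler_sum.
by rewrite -mulr_sumr ler_wpM2l.
Qed.

Lemma abs_summableB (R : realType) (f g : nat -> R[i]) :
  abs_summable f -> abs_summable g -> abs_summable (fun n => f n - g n).
Proof.
move=> [B fB] [C gC]; exists (B + C) => n.
apply: (@le_trans _ _ (\sum_(i < n) (`|f i| + `|g i|))).
  by apply: ler_sum => i _; apply: ler_normB.
by rewrite big_split lerD.
Qed.

Lemma abs_summable_shift (R : realType) (N : nat) (f : nat -> R[i]) :
  abs_summable f -> abs_summable (fun n => f (N + n)%N).
Proof.
move=> [B fB]; exists B => n; apply: le_trans (fB (N + n)%N).
by rewrite big_split_ord /= lerDr sumr_ge0.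
Qed.

Lemma abs_summable_tail1 (R : realType) (f : nat -> R[i]) :
  abs_summable (fun n => f n.+1) -> abs_summable f.
Proof.
move=> [B fB]; exists (`|f 0%N| + B) => n.
apply: (@le_trans _ _ (\sum_(i < n.+1) `|f i|)); last first.
  by rewrite big_ord_recl lerD2l; exact: fB.
by rewrite big_ord_recr lerDl.
Qed.

(** Transfers the completeness of the real numbers; it is applied to the real
    and to the imaginary parts of a complex series. *)
Lemma dominated_real_series_cvg (R : realType) (f : nat -> R[i]) : abs_summable f ->
  forall g : nat -> R, (forall n, (`|g n|%:C)%C <= `|f n|) -> cvgn (series g).
Proof.
move=> [B fB] g gf; apply: normed_cvg; apply: nondecreasing_is_cvgn.
  exact: (@nondecreasing_series _ (fun n => `|g n|) xpredT).
exists (complex.Re B) => _ [n _ <-].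
have h : ((\sum_(i < n) `|g i|)%:C)%C <= B.
  rewrite raddf_sum; apply: le_trans (fB n); apply: ler_sum => i _; exact: gf.
by move: h; rewrite lecE => /andP[_]; rewrite -(big_mkord xpredT (fun i => `|g i|)).
Qed.

Lemma normC_Re_Im_bounds (R : realType) (z : R[i]) :
  [/\ (`|complex.Re z|%:C)%C <= `|z|, (`|complex.Im z|%:C)%C <= `|z|
    & `|z| <= (`|complex.Re z| + `|complex.Im z|)%:C%C].
Proof.
case: z => x y; rewrite normc_def /= !lecR.
split.
- by rewrite -sqrtr_sqr ler_wsqrtr // lerDl sqr_ge0.
- by rewrite -sqrtr_sqr ler_wsqrtr // lerDr sqr_ge0.
have h : 0 <= `|x| + `|y| by rewrite addr_ge0.
rewrite -(ger0_norm h) -sqrtr_sqr ler_wsqrtr // sqrrD !real_normK ?num_real //.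
by rewrite lerD2r lerDl mulrn_wge0 // mulr_ge0.
Qed.

Lemma abs_summable_cvg (R : realType) (f : nat -> R[i]) :
  abs_summable f -> exists l, has_sum f l.
Proof.
move=> fs.
have /cvg_ex[lr hr] : cvgn (series (fun n => complex.Re (f n))).
  by apply: (dominated_real_series_cvg fs) => n; case: (normC_Re_Im_bounds (f n)).
have /cvg_ex[li hi] : cvgn (series (fun n => complex.Im (f n))).
  by apply: (dominated_real_series_cvg fs) => n; case: (normC_Re_Im_bounds (f n)).
exists (lr +i* li)%C; apply/cvgCP => e e0.
have [d d0 de] : exists2 d, 0 < d & e = (d%:C)%C.
  case: e e0 => d d'; rewrite ltcE /= => /andP[/eqP -> d0]; by exists d.
move: hr hi => /cvgrPdist_lt/(_ (d / 2))[|N _ hN]; first by rewrite divr_gt0.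
move=> /cvgrPdist_lt/(_ (d / 2))[|M _ hM]; first by rewrite divr_gt0.
exists (maxn N M) => n; rewrite geq_max => /andP[/hN/= hn /hM/= hm].
have [_ _] := normC_Re_Im_bounds ((lr +i* li)%C - \sum_(i < n) f i).
move=> /le_lt_trans; apply.
rewrite de ltcR (splitr d).
have -> : complex.Re ((lr +i* li)%C - \sum_(i < n) f i)
    = lr - series (fun n => complex.Re (f n)) n.
  by rewrite raddfB /= raddf_sum /series /= big_mkord.
have -> : complex.Im ((lr +i* li)%C - \sum_(i < n) f i)
    = li - series (fun n => complex.Im (f n)) n.
  by rewrite raddfB /= raddf_sum /series /= big_mkord.
exact: ltrD.
Qed.

Lemma ge0_cvg_abs_summable (R : realType) (f : nat -> R[i]) :
  (forall n, 0 <= f n) -> cvgn (series f) -> abs_summable f.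
Proof.
move=> f0 /cvg_ex[l /cvgCP/(_ 1 ltr01)[N hN]].
exists (`|l| + 1) => n.
rewrite (eq_bigr (fun i : 'I_n => f i)) => [|i _]; last by rewrite ger0_norm.
rewrite -(big_mkord xpredT f).
have le_nN : series f n <= series f (N + n)%N.
  by apply: (@nondecreasing_series _ f xpredT) => //; exact: leq_addl.
apply: le_trans le_nN _.
have -> : series f (N + n)%N = `|series f (N + n)%N|.
  by rewrite ger0_norm // sumr_ge0.
have tri (x : R[i]) : `|x| <= `|l| + `|l - x|.
  by rewrite -{1}(subKr l x) ler_normB.
apply: le_trans (tri _) _.
by rewrite lerD2l ltW // hN ?leq_addr.
Qed.

Lemma abs_summable_tail (R : realType) (f : nat -> R[i]) (e : R[i]) :
  abs_summable f -> 0 < e ->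
  exists N, forall m n, (N <= m)%N -> \sum_(i < n) `|f (m + i)%N| <= e.
Proof.
move=> fs e0.
have /abs_summable_cvg[l /cvgCP/(_ (e / 2))] :
    abs_summable (fun n => `|f n|).
  by case: fs => B fB; exists B => n; under eq_bigr do rewrite normr_id.
case; first by rewrite divr_gt0.
move=> N hN; exists N => m n Nm.
have -> : \sum_(i < n) `|f (m + i)%N|
    = `|\sum_(i < m + n) `|f i| - \sum_(i < m) `|f i| |.
  rewrite big_split_ord /= addrAC subrr add0r ger0_norm //.
  by rewrite sumr_ge0.
have tri (x y : R[i]) : `|x - y| <= `|l - y| + `|l - x|.
  by rewrite -(subrKA l) addrC (le_trans (ler_normD _ _)) // lerD // distrC.
apply: le_trans (tri _ _) _; rewrite (splitr e).
by apply: lerD; apply/ltW/hN => //; apply: leq_trans Nm (leq_addr _ _).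
Qed.

Lemma abs_summable_sum_le (R : realType) (f : nat -> R[i]) (B l : R[i]) :
  (forall n, \sum_(i < n) `|f i| <= B) -> has_sum f l -> `|l| <= B.
Proof.
move=> fB; apply: norm_limC_le => n; apply: le_trans (fB n).
exact: ler_norm_sum.
Qed.

Lemma abs_summable_geo (R : realType) (q : R[i]) :
  `|q| < 1 -> abs_summable (fun n => q ^+ n).
Proof.
move=> q1; exists (1 - `|q|)^-1 => n.
have p0 : 0 < 1 - `|q| by rewrite subr_gt0.
under eq_bigr do rewrite normrX.
rewrite -(ler_pM2l p0) mulfV ?gt_eqF // -[1 - `|q|]opprB mulNr -subrX1.
by rewrite opprB lerBlDr lerDl exprn_ge0.
Qed.

Lemma abs_summable_cvg0 (R : realType) (f : nat -> R[i]) :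
  abs_summable f -> f @ \oo --> 0.
Proof.
move=> /abs_summable_cvg[l /has_sumP fl]; apply: (@cvg_series_cvg_0 R[i] R[i]).
by apply/cvg_ex; exists l.
Qed.

(** Fubini for a triangular array. The N-th partial sums of the two series
    differ by the terms with k < N <= n, and these are bounded by the tail of
    the absolutely convergent series of row sums. *)
Lemma triangular_sum_exchange (R : realType) (T : nat -> nat -> R[i])
    (C : nat -> R[i]) :
  (forall n k, (n < k)%N -> T n k = 0) ->
  abs_summable (fun n => \sum_(k < n.+1) `|T n k|) ->
  (forall k, has_sum (fun n => T n k) (C k)) ->
  exists2 l, has_sum (fun n => \sum_(k < n.+1) T n k) l & has_sum C l.
Proof.
move=> T0 sM TC; pose M n := \sum_(k < n.+1) `|T n k|.
have M0 n : `|M n| = M n by rewrite ger0_norm // sumr_ge0.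
have [l hl] : exists l, has_sum (fun n => \sum_(k < n.+1) T n k) l.
  apply: abs_summable_cvg; apply: (abs_summable_le (C := 1)) sM => // n.
  by rewrite mul1r M0 ler_norm_sum.
exists l => //; apply/cvgCP => e e0.
have e2 : 0 < e / 2 by rewrite divr_gt0.
have [N1 hN1] := abs_summable_tail sM e2.
have [N2 hN2] := (cvgCP _ _).1 hl _ e2.
exists (maxn N1 N2) => N; rewrite geq_max => /andP[/hN1 h1 /hN2 h2].
rewrite -(subrKA (\sum_(n < N) \sum_(k < n.+1) T n k)).
apply: le_lt_trans (ler_normD _ _) _; rewrite (splitr e) ltr_leD //.
rewrite distrC.
have -> : \sum_(n < N) \sum_(k < n.+1) T n k
    = \sum_(k < N) \sum_(n < N) T n k.
  rewrite exchange_big /=; apply: eq_bigr => n _.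
  rewrite (big_ord_widen N (fun k => T n k)) // big_mkcond /=.
  by apply: eq_bigr => k _; case: ltnP => // /T0.
rewrite -sumrB.
apply: (@norm_limC_le _ (fun p => \sum_(k < N)
   (\sum_(n < N + p) T n k - \sum_(n < N) T n k))) => [p|].
  apply: le_trans (h1 p).
  have -> : \sum_(k < N)
   (\sum_(n < N + p) T n k - \sum_(n < N) T n k)
     = \sum_(i < p) \sum_(k < N) T (N + i)%N k.
    rewrite exchange_big /=; apply: eq_bigr => k _.
    by rewrite big_split_ord /= addrAC subrr add0r.
  apply: le_trans (ler_norm_sum _ _ _) _; apply: ler_sum => i _.
  rewrite M0; apply: le_trans (ler_norm_sum _ _ _) _.
  rewrite /M (big_ord_widen (N + i).+1 (fun k => `|T (N + i)%N k|)) ?leqW ?leq_addr //.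
  by rewrite big_mkcond /=; apply: ler_sum => k _; case: ifP.
apply: (@cvgC_bigsum _ N
  (fun k p => \sum_(n < N + p) T n k - \sum_(n < N) T n k)
  (fun k => C k - \sum_(n < N) T n k)) => k _.
apply: cvgCB; last exact: cvgC_cst.
apply/cvgCP => d /((cvgCP _ _).1 (TC k))[K hK]; exists K => n Kn.
by apply: hK; rewrite (leq_trans Kn) ?leq_addl.
Qed.

(** Continuity at 0, along w q^N, of a power series that converges absolutely
    at w: the terms of positive index are all damped by at least |q|^N. *)
Lemma has_sum_qscale_cvg (R : realType) (q : R[i]) (f E : nat -> R[i]) :
  `|q| < 1 -> abs_summable f ->
  (forall N, has_sum (fun n => f n * (q ^+ N) ^+ n) (E N)) ->
  E @ \oo --> f 0%N.
Proof.
move=> q1 [B fB] fE.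
have B0 : 0 <= B by apply: le_trans (fB 0%N); rewrite big_ord0.
have EN N : `|f 0%N - E N| <= B * `|q ^+ N|.
  have [l hl] : exists l, has_sum (fun n => f n.+1 * (q ^+ N) ^+ n.+1) l.
    apply: abs_summable_cvg; exists B => n.
    apply: le_trans (fB n.+1); rewrite big_ord_recl /= ler_wpDl //.
    apply: ler_sum => i _; rewrite normrM ler_piMr // !normrX.
    by rewrite exprn_ile1 ?exprn_ge0 // exprn_ile1 // ltW.
  have := @has_sum_tail _ (fun n => f n * (q ^+ N) ^+ n) l 1 hl.
  move=> /(has_sum_unique (fE N)) ->.
  rewrite big_ord1 expr0 mulr1 opprD addrA subrr add0r normrN.
  apply: abs_summable_sum_le hl => n.
  apply: (@le_trans _ _ (\sum_(i < n) `|f i.+1| * `|q ^+ N|)).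
    apply: ler_sum => i _; rewrite normrM ler_wpM2l // exprS normrM.
    by rewrite ler_piMr // !normrX exprn_ile1 ?exprn_ge0 // exprn_ile1 // ltW.
  rewrite -mulr_suml ler_wpM2r //; apply: le_trans (fB n.+1).
  by rewrite big_ord_recl /= ler_wpDl.
have qN : (fun N => B * q ^+ N) @ \oo --> 0.
  rewrite -(mulr0 B); apply: cvgCM; first exact: cvgC_cst.
  exact: abs_summable_cvg0 (abs_summable_geo q1).
apply/cvgCP => e /((cvgCP _ _).1 qN)[N hN]; exists N => n /hN.
rewrite sub0r normrN normrM (ger0_norm B0).
exact: le_lt_trans.
Qed.

(** * Infinite products and q-shifted factorials *)

(** With a small sum of the |a k|, the partial products stay within distance 1/2
    of 1. This bounds them and keeps them away from 0 at the same time. *)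
Lemma prod_sub1_le (R : realType) (a : nat -> R[i]) (n : nat) :
  \sum_(k < n) `|a k| <= 4^-1 ->
  `|\prod_(k < n) (1 - a k) - 1| <= 2 * \sum_(k < n) `|a k|.
Proof.
elim: n => [|n IHn]; first by rewrite !big_ord0 subrr normr0 mulr0.
rewrite !big_ord_recr /=.
set P := \prod_(i < n) _ in IHn *; set S := \sum_(i < n) _ in IHn *.
move=> Sn; have S4 : S <= 4^-1 by apply: le_trans Sn; rewrite lerDl.
have -> : P * (1 - a n) - 1 = (P - 1) - a n * P.
  by rewrite mulrBr mulr1 addrAC (mulrC P).
apply: le_trans (ler_normB _ _) _; rewrite mulrDr lerD ?IHn // normrM mulrC.
rewrite ler_wpM2r // -(subrK 1 P); apply: le_trans (ler_normD _ _) _.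
rewrite normr1 -lerBrDr (le_trans (IHn S4)) //.
apply: (@le_trans _ _ (2 * 4^-1)); first by rewrite ler_pM2l.
rewrite -[4]/(2 * 2)%:R natrM invfM mulrA mulfV ?mul1r ?pnatr_eq0 //.
by rewrite (_ : 2 - 1 = 1) ?invf_le1 ?ler1n // mulr2n addrK.
Qed.

(** After finitely many factors the sum of the remaining |a k| is at most 1/4.
    The products of the remaining factors are then bounded, so their increments
    are absolutely summable, and they stay within 1/2 of 1, so their limit is
    not 0. *)
Lemma infinite_prod_cvg (R : realType) (a : nat -> R[i]) :
  abs_summable a ->
  exists2 l, (fun n => \prod_(k < n) (1 - a k)) @ \oo --> l
    & ((forall k, 1 - a k != 0) -> l != 0).
Proof.
move=> sa.
have [N hN] := abs_summable_tail sa (e := 4^-1) ltac:(by rewrite invr_gt0).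
pose Q n := \prod_(k < n) (1 - a (N + k)%N).
have Q1 n : `|Q n - 1| <= 2^-1.
  apply: (le_trans (@prod_sub1_le _ (fun k => a (N + k)%N) n (hN N n (leqnn N)))).
  apply: (@le_trans _ _ (2 * 4^-1)); first by rewrite ler_pM2l // hN.
  by rewrite -[4]/(2 * 2)%:R natrM invfM mulrA mulfV ?mul1r ?pnatr_eq0.
have QS n : Q n.+1 - Q n = - (a (N + n)%N * Q n).
  by rewrite /Q big_ord_recr /= mulrBr mulr1 addrAC subrr add0r mulrC.
have sQ : abs_summable (fun n => Q n.+1 - Q n).
  have Q2 n : `|Q n.+1 - Q n| <= 2 * `|a (N + n)%N|.
    rewrite QS normrN normrM mulrC ler_wpM2r //.
    rewrite -(subrK 1 (Q n)); apply: le_trans (ler_normD _ _) _.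
    rewrite normr1 -lerBrDr (le_trans (Q1 n)) //.
    by rewrite (_ : 2 - 1 = 1) ?invf_le1 ?ler1n // mulr2n addrK.
  exact: (abs_summable_le (ler0n _ 2) Q2 (abs_summable_shift N sa)).
have [m hm] : exists m : R[i], Q n @[n --> \oo] --> m.
  have [m hm] := abs_summable_cvg sQ.
  exists (1 + m); have -> : Q = fun n => 1 + \sum_(i < n) (Q i.+1 - Q i).
    apply/funext => n; rewrite -(big_mkord xpredT (fun i => Q i.+1 - Q i)).
    rewrite telescope_sumr // /Q big_ord0.
    by rewrite addrC subrK.
  apply: cvgCD; [exact: cvgC_cst|exact: hm].
have m0 : m != 0.
  have : `|m - 1| <= 2^-1.
    by apply: (norm_limC_le Q1); apply: cvgCB; [exact: hm|exact: cvgC_cst].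
  apply: contraTneq => ->; rewrite sub0r normrN normr1.
  by rewrite -real_ltNge ?invf_lt1 ?ltr1n // rpredV realn.
exists (\prod_(k < N) (1 - a k) * m) => [|a1]; last first.
  by rewrite mulf_neq0 //; apply/prodf_neq0 => k _.
apply: (@cvgC_shift _ N).
have -> : (fun n => \prod_(k < N + n) (1 - a k))
    = (fun n => \prod_(k < N) (1 - a k) * Q n).
  by apply/funext => n; rewrite big_split_ord.
apply: cvgCM; [exact: cvgC_cst|exact: hm].
Qed.

Lemma qpoch0 (K : fieldType) (c q : K) : qpoch c q 0 = 1.
Proof. by rewrite /qpoch big_ord0. Qed.

Lemma qpochS (K : fieldType) (c q : K) (n : nat) :
  qpoch c q n.+1 = qpoch c q n * (1 - c * q ^+ n).
Proof. by rewrite /qpoch big_ord_recr. Qed.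

Lemma qpochSl (K : fieldType) (c q : K) (n : nat) :
  qpoch c q n.+1 = (1 - c) * qpoch (q * c) q n.
Proof.
rewrite /qpoch big_ord_recl expr0 mulr1; congr (_ * _).
by apply: eq_bigr => i _; rewrite exprS mulrA (mulrC c).
Qed.

Lemma qpoch_neq0 (K : fieldType) (c q : K) (n k : nat) :
  qpoch c q n != 0 -> (k < n)%N -> 1 - c * q ^+ k != 0.
Proof. by move=> /prodf_neq0 h kn; apply: (h (Ordinal kn)). Qed.

(** This is what makes the 3Phi2 series with upper parameter q^(-n) terminate. *)
Lemma qpoch_expN_eq0 (K : fieldType) (q : K) (n k : nat) :
  q != 0 -> (n < k)%N -> qpoch (q ^- n) q k = 0.
Proof.
move=> q0 nk; apply/eqP/prodf_eq0; exists (Ordinal nk) => //=.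
by rewrite mulVf ?subrr // expf_neq0.
Qed.

Lemma qpochs_eq0_leq (K : fieldType) (cs : seq K) (q : K) (m n : nat) :
  (m <= n)%N -> qpochs cs q m = 0 -> qpochs cs q n = 0.
Proof.
move=> /subnKC <-; rewrite /qpochs => /eqP; rewrite prodf_seq_eq0.
move=> /hasP[c cs_c /= c0].
apply/eqP; rewrite prodf_seq_eq0; apply/hasP; exists c => //=.
by rewrite /qpoch big_split_ord /= mulf_eq0 (c0 : \prod_(k < m) _ == 0).
Qed.

Lemma qpoch_q_neq0 (R : realType) (q : R[i]) (n : nat) :
  `|q| < 1 -> qpoch q q n != 0.
Proof.
move=> q1; apply/prodf_neq0 => k _; rewrite -exprS subr_eq0.
apply/eqP => /(congr1 (fun z => `|z|)); rewrite normr1 normrX => /eqP.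
by rewrite eq_sym lt_eqF // exprn_ilt1.
Qed.

Lemma qpoch_inf_cvg (R : realType) (c q : R[i]) : `|q| < 1 ->
  qpoch c q n @[n --> \oo] --> qpoch_inf c q
  /\ ((forall k, 1 - c * q ^+ k != 0) -> qpoch_inf c q != 0).
Proof.
move=> q1.
have sq : abs_summable (fun k => c * q ^+ k).
  apply: (abs_summable_le (normr_ge0 c)) (abs_summable_geo q1) => k.
  by rewrite normrM.
have [l hl l0] := infinite_prod_cvg sq.
have lE : qpoch_inf c q = l by rewrite /qpoch_inf; exact: cvg_lim.
by rewrite lE; split.
Qed.

Lemma qpoch_inf_eq0 (R : realType) (c q : R[i]) :
  `|q| < 1 -> qpoch_inf c q = 0 -> exists k, c * q ^+ k = 1.
Proof.
move=> q1 c0; apply: contrapT => h; move: c0; apply/eqP.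
apply: (qpoch_inf_cvg c q1).2 => k; rewrite subr_eq0 eq_sym.
by apply/eqP => ck; apply: h; exists k.
Qed.

Lemma qpoch_infS (R : realType) (c q : R[i]) : `|q| < 1 ->
  qpoch_inf c q = (1 - c) * qpoch_inf (q * c) q.
Proof.
move=> q1; have [h _] := qpoch_inf_cvg c q1; have [h' _] := qpoch_inf_cvg (q * c) q1.
have hS : qpoch c q n @[n --> \oo] --> (1 - c) * qpoch_inf (q * c) q.
  apply: (@cvgC_shift _ 1).
  have -> : (fun n => qpoch c q (1 + n)) = (fun n => (1 - c) * qpoch (q * c) q n).
    by apply/funext => n; rewrite add1n qpochSl.
  by apply: cvgCM; [exact: cvgC_cst|exact: h'].
exact: cvgC_unique h hS.
Qed.

Lemma prod_expr_bin2 (K : fieldType) (q : K) (n : nat) :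
  \prod_(k < n) q ^+ k = q ^+ 'C(n, 2).
Proof.
rewrite -(big_mkord xpredT (fun k => q ^+ k)) -expr_sum; congr (_ ^+ _).
by rewrite bin2_sum.
Qed.

(** The shifted factorial in the Hahn polynomial multiplies the factors
    1 - al q^(-k); pulling out - al q^(-k) from each gives (1/al; q)_n. *)
Lemma qpoch_reversal (K : fieldType) (q al : K) (n : nat) :
  q != 0 -> al != 0 ->
  q ^+ 'C(n, 2) * qpoch (al * q ^ (1 - n%:Z)) q n
    = (- al) ^+ n * qpoch al^-1 q n.
Proof.
move=> q0 al0; rewrite /qpoch -prod_expr_bin2.
rewrite [X in _ * X](reindex_inj rev_ord_inj) /=.
have -> : (- al) ^+ n = \prod_(k < n) - al by rewrite prodr_const card_ord.
rewrite -!big_split /=; apply: eq_bigr => i _.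
have -> : q ^ (1 - n%:Z) = q / q ^+ n.
  by rewrite expfzDr // expr1z exprnN.
have -> : q ^+ n = q ^+ (n - i.+1) * q ^+ i * q.
  by rewrite -exprD -exprSr -addnS subnK.
have qi : q ^+ i != 0 by rewrite expf_neq0.
have qj : q ^+ (n - i.+1) != 0 by rewrite expf_neq0.
by field; rewrite q0 qi qj al0.
Qed.

Lemma bin2_addn (n m : nat) : 'C(n + m, 2) = ('C(n, 2) + 'C(m, 2) + n * m)%N.
Proof.
elim: m => [|m IHm]; first by rewrite addn0 muln0 !addn0.
by rewrite addnS !binS !bin1 IHm mulnS; lia.
Qed.

(** * The generating function of the Hahn polynomials *)

Definition cauchy_prod (K : fieldType) (f g : nat -> K) (n : nat) : K :=
  \sum_(i < n.+1) f i * g (n - i)%N.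

(** Multiplication by the variable, for sequences seen as formal power series. *)
Definition shift_seq (K : fieldType) (f : nat -> K) (n : nat) : K :=
  if n is m.+1 then f m else 0.

Lemma cauchy_prod_shiftl (K : fieldType) (f g : nat -> K) (n : nat) :
  cauchy_prod (shift_seq f) g n = shift_seq (cauchy_prod f g) n.
Proof.
case: n => [|n]; first by rewrite /cauchy_prod big_ord1 mul0r.
by rewrite /cauchy_prod big_ord_recl mul0r add0r.
Qed.

Lemma cauchy_prod_shiftr (K : fieldType) (f g : nat -> K) (n : nat) :
  cauchy_prod f (shift_seq g) n = shift_seq (cauchy_prod f g) n.
Proof.
case: n => [|n]; first by rewrite /cauchy_prod big_ord1 mulr0.
rewrite /cauchy_prod big_ord_recr /= subnn mulr0 addr0.
by apply: eq_bigr => i _; rewrite subSn // -ltnS.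
Qed.

(** As formal power series, the hypotheses say (1 - c X) U(X) = (1 - m X) U(q X)
    and V(X) = (1 - X) V(q X). The conclusion is the product of these two
    equations, (1 - c X) E(X) = (1 - m X) (1 - X) E(q X) with E = U V, read
    coefficientwise. Convergence is not involved. *)
Lemma cauchy_prod_functional (K : fieldType) (q c m : K) (u v : nat -> K) :
  (forall n, u n.+1 * (1 - q ^+ n.+1) = (c - m * q ^+ n) * u n) ->
  (forall n, v n.+1 * (1 - q ^+ n.+1) = - q ^+ n * v n) ->
  forall n, let e := cauchy_prod u v in let e' n := q ^+ n * e n in
  e n - c * shift_seq e n
  = e' n - (1 + m) * shift_seq e' n + m * shift_seq (shift_seq e') n.
Proof.
move=> Hu Hv n e e'.
pose u' n := q ^+ n * u n; pose v' n := q ^+ n * v n.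
have eE' : e' =1 cauchy_prod u' v'.
  move=> i; rewrite /e' mulr_sumr; apply: eq_bigr => j _.
  rewrite /u' /v' -{1}(subnKC (ltnSE (ltn_ord j))) exprD; ring.
have shE (f g : nat -> K) : f =1 g -> shift_seq f =1 shift_seq g.
  by move=> fg [|i] //=.
rewrite eE' (shE _ _ eE') (shE _ _ (shE _ _ eE')).
have Hu0 j : u j - c * shift_seq u j = u' j - m * shift_seq u' j.
  case: j => [|j] /=; first by rewrite /u' expr0 mul1r !mulr0.
  by rewrite /u'; have := Hu j; rewrite mulrBr mulr1 => /(canRL (subrK _)) {1}->; ring.
have Hv0 j : v j = v' j - shift_seq v' j.
  case: j => [|j] /=; first by rewrite /v' expr0 mul1r subr0.
  by rewrite /v'; have := Hv j; rewrite mulrBr mulr1 => /(canRL (subrK _)) {1}->; ring.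
transitivity (cauchy_prod (fun j => u j - c * shift_seq u j) v n).
  rewrite -cauchy_prod_shiftl mulr_sumr -sumrB; apply: eq_bigr => j _; ring.
transitivity (cauchy_prod (fun j => u' j - m * shift_seq u' j)
                          (fun j => v' j - shift_seq v' j) n).
  by apply: eq_bigr => j _; rewrite -Hu0 -Hv0.
have -> : shift_seq (shift_seq (cauchy_prod u' v')) n
    = cauchy_prod (shift_seq u') (shift_seq v') n.
  rewrite cauchy_prod_shiftl; apply: shE => i; by rewrite cauchy_prod_shiftr.
have -> : (1 + m) * shift_seq (cauchy_prod u' v') n
    = cauchy_prod u' (shift_seq v') n + m * cauchy_prod (shift_seq u') v' n.
  by rewrite cauchy_prod_shiftl cauchy_prod_shiftr mulrDl mul1r.
rewrite opprD addrA !mulr_sumr -!sumrB -big_split /=; apply: eq_bigr => j _.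
ring.
Qed.

Lemma has_sum_shift_seq (R : realType) (f : nat -> R[i]) (l : R[i]) :
  has_sum f l -> has_sum (shift_seq f) l.
Proof.
move=> fl; have := @has_sum_tail _ (shift_seq f) l 1 fl.
by rewrite big_ord1 /= add0r.
Qed.

(** The coefficientwise functional equation, summed at a point of convergence. *)
Lemma functional_eq_sum (R : realType) (q c m z E E' : R[i]) (e : nat -> R[i]) :
  (forall n, let e' n := q ^+ n * e n in
     e n - c * shift_seq e n
     = e' n - (1 + m) * shift_seq e' n + m * shift_seq (shift_seq e') n) ->
  has_sum (fun n => e n * z ^+ n) E ->
  has_sum (fun n => e n * (z * q) ^+ n) E' ->
  (1 - c * z) * E = (1 - m * z) * (1 - z) * E'.
Proof.
move=> eE; set F := (F in has_sum F E) => hF hE'.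
pose F' n := q ^+ n * e n * z ^+ n.
have hF' : has_sum F' E'.
  by move: hE'; congr has_sum; apply/funext => n; rewrite /F' exprMn; ring.
have h1 := has_sumB hF (has_sumZ (c := c * z) (has_sum_shift_seq hF)).
have h2 := has_sumD
  (has_sumB hF' (has_sumZ (c := (1 + m) * z) (has_sum_shift_seq hF')))
  (has_sumZ (c := m * z ^+ 2) (has_sum_shift_seq (has_sum_shift_seq hF'))).
transitivity (E - c * z * E); first by ring.
transitivity (E' - (1 + m) * z * E' + m * z ^+ 2 * E'); last by ring.
apply: has_sum_unique h1 _; move: h2; congr has_sum; apply/funext => n.
apply/esym/subr0_eq.
transitivity ((e n - c * shift_seq e n - (q ^+ n * e n
    - (1 + m) * shift_seq (fun n => q ^+ n * e n) n
    + m * shift_seq (shift_seq (fun n => q ^+ n * e n)) n)) * z ^+ n).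
  by case: n => [|[|n]]; rewrite /F /F' /= !(expr0, exprS); ring.
by rewrite eE subrr mul0r.
Qed.

(** Iterating the functional equation gives
    (c w)_N E(w) = (m w)_N (w)_N E(w q^N), and E(w q^N) tends to e 0 = 1.
    Only absolute convergence at w is needed, so the formula also holds at points
    with |c w| >= 1, which the induction on k visits. *)
Lemma functional_eq_solution (R : realType) (q c m w : R[i]) (e : nat -> R[i]) :
  `|q| < 1 -> (forall k, 1 - c * w * q ^+ k != 0) -> e 0%N = 1 ->
  (forall n, let e' n := q ^+ n * e n in
     e n - c * shift_seq e n
     = e' n - (1 + m) * shift_seq e' n + m * shift_seq (shift_seq e') n) ->
  abs_summable (fun n => e n * w ^+ n) ->
  has_sum (fun n => e n * w ^+ n)
    (qpochs_inf [:: m * w; w] q / qpoch_inf (c * w) q).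
Proof.
move=> q1 cw e0 eE se.
have sN N : exists l, has_sum (fun n => e n * w ^+ n * (q ^+ N) ^+ n) l.
  apply: abs_summable_cvg; apply: (abs_summable_le ler01) se => n.
  rewrite mul1r normrM ler_piMr // !normrX.
  by rewrite exprn_ile1 ?exprn_ge0 // exprn_ile1 // ltW.
pose E N := projT1 (cid (sN N)).
have hE N : has_sum (fun n => e n * w ^+ n * (q ^+ N) ^+ n) (E N).
  exact: projT2 (cid (sN N)).
have Elim : E @ \oo --> (1 : R[i]).
  by have := has_sum_qscale_cvg q1 se hE; rewrite e0 mul1r.
have step N : (1 - c * w * q ^+ N) * E N
    = (1 - m * w * q ^+ N) * (1 - w * q ^+ N) * E N.+1.
  rewrite -!(mulrA _ w); apply: (functional_eq_sum eE).
    by have := hE N; congr has_sum; apply/funext => n; rewrite exprMn mulrA.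
  have := hE N.+1; congr has_sum; apply/funext => n.
  by rewrite -(mulrA w) -exprSr exprMn mulrA.
have prodE N : qpoch (c * w) q N * E 0%N = qpoch (m * w) q N * qpoch w q N * E N.
  elim: N => [|N IHN]; first by rewrite !qpoch0 !mul1r.
  rewrite !qpochS mulrAC IHN.
  transitivity (qpoch (m * w) q N * qpoch w q N * ((1 - c * w * q ^+ N) * E N)).
    ring.
  rewrite step; ring.
have [hc /(_ cw) c0] := qpoch_inf_cvg (c * w) q1.
have [hm _] := qpoch_inf_cvg (m * w) q1.
have [hw _] := qpoch_inf_cvg w q1.
have E0 : qpoch_inf (c * w) q * E 0%N = qpoch_inf (m * w) q * qpoch_inf w q * 1.
  apply: (@cvgC_unique _ (fun N => qpoch (c * w) q N * E 0%N)).
    by apply: cvgCM; [exact: hc|exact: cvgC_cst].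
  under eq_fun do rewrite prodE.
  by apply: cvgCM; [apply: cvgCM; [exact: hm|exact: hw]|exact: Elim].
have -> : qpochs_inf [:: m * w; w] q / qpoch_inf (c * w) q = E 0%N.
  apply: (mulfI c0); rewrite E0 mulr1 mulrC divfK //.
  by rewrite /qpochs_inf !big_cons big_nil mulr1.
have := hE 0%N; congr has_sum; apply/funext => n.
by rewrite expr0 expr1n mulr1.
Qed.

Lemma functional_eq_unique (K : fieldType) (q c m : K) (e f : nat -> K) :
  (forall n, 1 - q ^+ n.+1 != 0) ->
  (forall n, let e' n := q ^+ n * e n in
     e n - c * shift_seq e n
     = e' n - (1 + m) * shift_seq e' n + m * shift_seq (shift_seq e') n) ->
  (forall n, let f' n := q ^+ n * f n in
     f n - c * shift_seq f n
     = f' n - (1 + m) * shift_seq f' n + m * shift_seq (shift_seq f') n) ->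
  e 0%N = f 0%N -> e =1 f.
Proof.
move=> qS eE fE ef0 n.
(* The functional equation is a recurrence of order two. *)
suff [] : e n = f n /\ e n.+1 = f n.+1 by [].
elim: n => [|n [IH0 IH1]]; split=> //.
  apply: (mulIf (qS 0)); apply/eqP; rewrite -subr_eq0; apply/eqP.
  transitivity ((e 1%N - c * e 0%N - (q ^+ 1 * e 1%N
      - (1 + m) * (q ^+ 0 * e 0%N) + m * 0))
    - (f 1%N - c * f 0%N - (q ^+ 1 * f 1%N
      - (1 + m) * (q ^+ 0 * f 0%N) + m * 0))).
    by rewrite ef0; ring.
  by rewrite (eE 1%N) (fE 1%N) /= !subrr.
apply: (mulIf (qS n.+1)); apply/eqP; rewrite -subr_eq0; apply/eqP.
transitivity ((e n.+2 - c * e n.+1 - (q ^+ n.+2 * e n.+2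
    - (1 + m) * (q ^+ n.+1 * e n.+1) + m * (q ^+ n * e n)))
  - (f n.+2 - c * f n.+1 - (q ^+ n.+2 * f n.+2
    - (1 + m) * (q ^+ n.+1 * f n.+1) + m * (q ^+ n * f n)))).
  by rewrite IH0 IH1; ring.
by rewrite (eE n.+2) (fE n.+2) /= !subrr.
Qed.

(** The powers of q combine because binom(j + l, 2) = binom(j, 2) + binom(l, 2)
    + j l, where the last term is the one occurring in the Hahn polynomial. *)
Lemma hahn_psi_cauchy_prod (K : fieldType) (q al mu : K) (n : nat) :
  q != 0 -> al != 0 -> (forall n, qpoch q q n != 0) ->
  (-1) ^+ n * q ^+ 'C(n, 2) * hahn_psi al n mu q / qpoch q q n
  = cauchy_prod (fun j => qpoch al^-1 q j * (al * mu) ^+ j / qpoch q q j)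
      (fun l => (-1) ^+ l * q ^+ 'C(l, 2) / qpoch q q l) n.
Proof.
move=> q0 al0 qq.
rewrite /hahn_psi mulr_sumr mulr_suml; apply: eq_bigr => -[j /=].
rewrite ltnS => /subnKC; set l := (n - j)%N => <- _.
have -> : q ^ (j%:Z * (j%:Z - (j + l)%:Z)) = (q ^+ (j * l))^-1.
  by rewrite exprnN; congr (q ^ _); lia.
rewrite bin2_addn /qbinom addKn.
have := qpoch_reversal j q0 al0; set P := qpoch (al * _) q j.
have qC : q ^+ 'C(j, 2) != 0 by rewrite expf_neq0.
have qjl : q ^+ (j * l) != 0 by rewrite expf_neq0.
move=> /(canRL (mulKf qC)) ->.
rewrite !exprD !exprMn [(- al) ^+ j]exprNn.
have := qq j; have := qq l; have := qq (j + l)%N.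
have sj : (-1) ^+ j * (-1) ^+ j = 1 :> K by rewrite -expr2 sqrr_sign.
move=> h1 h2 h3.
transitivity (((-1) ^+ j * (-1) ^+ j) * ((-1) ^+ l * q ^+ 'C(l, 2) *
   (al ^+ j * qpoch al^-1 q j) * mu ^+ j / (qpoch q q j * qpoch q q l))).
  by field; rewrite h1 h2 h3 qC qjl.
rewrite sj; by field; rewrite h2 h3.
Qed.

(** The coefficient e_n of z^n in (mu z, z)_oo / (al mu z)_oo. *)
Definition hahn_coef (K : fieldType) (q al mu : K) (n : nat) : K :=
  (-1) ^+ n * q ^+ 'C(n, 2) * hahn_psi al n mu q / qpoch q q n.

Lemma hahn_coef0 (K : fieldType) (q al mu : K) : hahn_coef q al mu 0 = 1.
Proof.
by rewrite /hahn_coef /hahn_psi big_ord1 /qbinom !qpoch0 !mul1r !invr1 !mulr1.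
Qed.

Lemma hahn_coef_functional (K : fieldType) (q al mu : K) :
  q != 0 -> al != 0 -> (forall n, qpoch q q n != 0) ->
  forall n, let e := hahn_coef q al mu in let e' n := q ^+ n * e n in
  e n - al * mu * shift_seq e n
  = e' n - (1 + mu) * shift_seq e' n + mu * shift_seq (shift_seq e') n.
Proof.
move=> q0 al0 qq n.
pose u j := qpoch al^-1 q j * (al * mu) ^+ j / qpoch q q j.
pose v l := (-1) ^+ l * q ^+ 'C(l, 2) / qpoch q q l.
have -> : hahn_coef q al mu = cauchy_prod u v.
  by apply/funext => i; exact: hahn_psi_cauchy_prod.
have qS i : 1 - q * q ^+ i != 0 := qpoch_neq0 (qq i.+1) (ltnSn i).
apply: cauchy_prod_functional => i.
  by rewrite /u !qpochS !exprS; field; rewrite qq al0 qS.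
by rewrite /v qpochS binS bin1 addnC exprD !exprS; field; rewrite qq qS.
Qed.

(** The generating function (mu z, z)_oo / (al mu z)_oo is invariant under
    al -> al mu, mu -> 1 / mu, z -> mu z. At the level of coefficients, both sides
    satisfy the functional equation that determines them. *)
Lemma hahn_psi_sym (K : fieldType) (q al mu : K) (n : nat) :
  q != 0 -> al != 0 -> mu != 0 -> (forall n, qpoch q q n != 0) ->
  hahn_psi al n mu q = mu ^+ n * hahn_psi (al * mu) n mu^-1 q.
Proof.
move=> q0 al0 mu0 qq.
have am0 : al * mu != 0 by rewrite mulf_neq0.
suff E : hahn_coef q al mu =1 (fun n => mu ^+ n * hahn_coef q (al * mu) mu^-1 n).
  have := E n; rewrite /hahn_coef mulrA => /(divIf (qq n)) En.
  apply: (@mulfI _ ((-1) ^+ n * q ^+ 'C(n, 2))).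
    by rewrite mulf_neq0 ?expf_neq0 ?oppr_eq0 ?oner_eq0.
  by rewrite En; ring.
apply: (@functional_eq_unique _ q (al * mu) mu).
- by move=> i; have := qpoch_neq0 (qq i.+1) (ltnSn i); rewrite -exprS.
- exact: hahn_coef_functional.
- move=> i; have := hahn_coef_functional mu^-1 q0 am0 qq i; rewrite /= mulfK //.
  move=> /(congr1 (fun x => mu ^+ i * x)).
  case: i => [|[|i]] /= h.
  + by move: h; rewrite !mulr0 !subr0 !addr0 => ->; ring.
  + apply: etrans (etrans h _); [ring|field]; done.
  + apply: etrans (etrans h _); [rewrite !exprS; ring|rewrite !exprS; field]; done.
by rewrite !hahn_coef0 expr0 mul1r.
Qed.

(** * The terminating hypergeometric sum *)

(** The 3Phi2 of upper parameters q^(-k), w, be and lower parameters g, 0, at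
    argument q, cut at i = k, beyond which the factor (q^(-k))_i vanishes. *)
Definition phi32_sum (K : fieldType) (q be w g : K) (k : nat) : K :=
  \sum_(i < k.+1) qpoch (q ^- k) q i * qpoch w q i * qpoch be q i
    / (qpoch g q i * qpoch q q i) * q ^+ i.

Lemma phi32_terminating (R : realType) (q a2 a3 b1 : R[i]) (j : nat) :
  q != 0 ->
  phi32 (q ^- j) a2 a3 b1 0 q q = phi32_sum q a3 a2 b1 j.
Proof.
move=> q0; rewrite /phi32.
have q0n n : qpoch 0 q n = 1 by rewrite /qpoch big1 // => i _; rewrite mul0r subr0.
have h : has_sum (fun i => qpochs [:: q ^- j; a2; a3] q i / qpochs [:: b1; 0] q i
    * (q ^+ i / qpoch q q i)) (phi32_sum q a3 a2 b1 j).
  rewrite /phi32_sum.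
  have -> : \sum_(i < j.+1) qpoch (q ^- j) q i * qpoch a2 q i * qpoch a3 q i
        / (qpoch b1 q i * qpoch q q i) * q ^+ i
      = \sum_(i < j.+1) (qpochs [:: q ^- j; a2; a3] q i / qpochs [:: b1; 0] q i
    * (q ^+ i / qpoch q q i)).
    apply: eq_bigr => i _; rewrite /qpochs !big_cons !big_nil !mulr1 q0n mulr1.
    by rewrite invfM -!mulrA; congr (_ * (_ * (_ * (_ * _)))); rewrite mulrC.
  apply: has_sum_finite => n jn.
  by rewrite /qpochs big_cons qpoch_expN_eq0 // !mul0r.
by apply: cvg_lim => //; apply/has_sumP.
Qed.

Lemma qpoch_expN_step (K : fieldType) (q : K) (k i : nat) : q != 0 ->
  q ^+ i.+1 * qpoch (q ^- k.+1) q i.+1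
  = qpoch (q ^- k) q i.+1 - (1 - q ^+ i.+1) * qpoch (q ^- k) q i.
Proof.
move=> q0; rewrite qpochSl qpochS.
have -> : q * q ^- k.+1 = q ^- k by rewrite exprS invfM mulrA mulfV ?mul1r.
have qk : q ^+ k != 0 by rewrite expf_neq0.
rewrite !exprS; by field; rewrite q0 qk.
Qed.

(** The relation that matches q / z (S_k(z) - S_k(z / q)) = S_(k+1)(z): for
    w = q / z, be = 1 / al and g = q / (al mu z), the coefficient of the last sum is
    w G(z / q) / G(z). With R_i = (w)_i / (g)_i, the identity
    w q^i R_i = R_i - (1 - g q^i) R_(i+1) reduces each pair of terms on the right to
    R_i - (1 - be q^i) R_(i+1), and a summation by parts gives the left-hand side. *)
Lemma phi32_sum_rec (K : fieldType) (q be w g : K) (k : nat) :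
  q != 0 -> (forall n, qpoch q q n != 0) -> (forall n, qpoch g q n != 0) ->
  phi32_sum q be w g k.+1
  = w * phi32_sum q be w g k
    - (g - be) * (1 - w) / (1 - g) * phi32_sum q be (q * w) (q * g) k.
Proof.
move=> q0 qq gg.
have g1 : 1 - g != 0 by have := qpoch_neq0 (gg 1%N) (ltnSn 0); rewrite mulr1.
pose r i := qpoch w q i / qpoch g q i.
pose d i := qpoch (q ^- k) q i * qpoch be q i / qpoch q q i.
(* Summation by parts: the upper limit k can be raised to k + 1 at no cost,
   since d (k + 1) = 0. *)
transitivity (\sum_(i < k.+1) d i * r i
              - \sum_(i < k.+1) d i * (1 - be * q ^+ i) * r i.+1).
  have dk : d k.+1 = 0 by rewrite /d qpoch_expN_eq0 ?mul0r.
  have -> : \sum_(i < k.+1) d i * r i = \sum_(i < k.+2) d i * r i.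
    by rewrite [RHS]big_ord_recr /= dk mul0r addr0.
  rewrite /phi32_sum big_ord_recl [X in _ = X - _]big_ord_recl -addrA -sumrB.
  congr (_ + _); first by rewrite /d /r !qpoch0 /= expr0 !mulr1 !invr1 !mulr1.
  apply: eq_bigr => i _; rewrite lift0.
  have qi : 1 - q ^+ i.+1 != 0.
    by have := qpoch_neq0 (qq i.+1) (ltnSn i); rewrite exprS.
  transitivity (q ^+ i.+1 * qpoch (q ^- k.+1) q i.+1 * qpoch be q i.+1
                 / qpoch q q i.+1 * r i.+1).
    by rewrite /r; field; rewrite qq gg.
  rewrite qpoch_expN_step // /d (qpochS be) (qpochS q q i) -exprS.
  by field; rewrite qq qi.
rewrite /phi32_sum !mulr_sumr -!sumrB; apply: eq_bigr => i _.
have gi : 1 - g * q ^+ i != 0 := qpoch_neq0 (gg i.+1) (ltnSn i).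
have := qpochSl w q i; rewrite qpochS => wE.
have := qpochSl g q i; rewrite qpochS => gE.
have gE' : qpoch (q * g) q i = qpoch g q i * (1 - g * q ^+ i) / (1 - g).
  by rewrite gE; field.
transitivity (d i * (w * q ^+ i * r i - (g - be) * q ^+ i * r i.+1)).
  rewrite /r !qpochS; field; rewrite ?gi gg //=.
rewrite /d /r gE' [qpoch w q i.+1]qpochSl qpochS; field; rewrite gi gg g1 qq //=.
Qed.

(** The counterpart for the 3Phi2 of the symmetry of the generating function:
    both sides satisfy the same recurrence in k. *)
Lemma phi32_sum_sym (K : fieldType) (q be w g : K) (k : nat) :
  q != 0 -> be != 0 -> w != 0 -> g != 0 ->
  (forall n, qpoch q q n != 0) -> (forall n, qpoch g q n != 0) ->
  phi32_sum q be w g k = (be * w / g) ^+ k * phi32_sum q (g / w) (g / be) g k.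
Proof.
move=> q0 be0 w0 g0 qq; elim: k w g w0 g0 => [|k IHk] w g w0 g0 gg.
  by rewrite /phi32_sum !big_ord1 !qpoch0 expr0 !mul1r.
have gq n : qpoch (q * g) q n != 0.
  by have := gg n.+1; rewrite qpochSl mulf_eq0 negb_or => /andP[].
have g1 : 1 - g != 0 by have := qpoch_neq0 (gg 1%N) (ltnSn 0); rewrite mulr1.
rewrite !phi32_sum_rec // (IHk w g) // (IHk (q * w) (q * g)) ?mulf_neq0 //.
have -> : be * (q * w) / (q * g) = be * w / g by field; rewrite q0 g0.
have -> : q * g / (q * w) = g / w by field; rewrite q0 w0.
have -> : q * g / be = q * (g / be) by rewrite mulrA.
rewrite exprS; set P := phi32_sum _ _ _ _ _; set P' := phi32_sum _ _ _ _ _.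
by field; rewrite be0 w0 g0 g1.
Qed.

(** * Generating functions of the shifted sequences *)

Definition shifted_term (K : fieldType) (q z : K) (h : nat -> K) (k m : nat) : K :=
  (-1) ^+ m * q ^+ 'C(m, 2) * z ^+ m * h (k + m)%N / qpoch q q m.

Lemma shifted_term0 (K : fieldType) (q z al mu : K) :
  shifted_term q z (fun n => hahn_psi al n mu q) 0
  = (fun n => hahn_coef q al mu n * z ^+ n).
Proof.
apply/funext => n; rewrite /shifted_term /hahn_coef add0n.
by rewrite [RHS]mulrAC; congr (_ / _); ring.
Qed.

(** Replacing z by z / q multiplies the term of index m by q^(-m), and the
    difference 1 - q^(-m) cancels the last factor of (q)_m. *)
Lemma shifted_term_diff (K : fieldType) (q z : K) (h : nat -> K) (k m : nat) :
  q != 0 -> (forall n, qpoch q q n != 0) ->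
  shifted_term q z h k m.+1 - shifted_term q (z / q) h k m.+1
  = z / q * shifted_term q z h k.+1 m.
Proof.
move=> q0 qq; rewrite /shifted_term addnS addSn binS bin1 addnC exprD qpochS !exprS.
have qm : 1 - q * q ^+ m != 0 := qpoch_neq0 (qq m.+1) (ltnSn m).
have qm0 : q ^+ m != 0 by rewrite expf_neq0.
rewrite [(z / q) ^+ m]exprMn exprVn; field; rewrite q0 qq qm qm0 //=.
Qed.

Lemma shifted_termS (K : fieldType) (q z : K) (h : nat -> K) (k m : nat) :
  (forall n, qpoch q q n != 0) ->
  shifted_term q z h k m.+1
  = - (z * q ^+ m / (1 - q ^+ m.+1)) * shifted_term q z h k.+1 m.
Proof.
move=> qq; rewrite /shifted_term addnS addSn binS bin1 addnC exprD qpochS !exprS.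
have qm : 1 - q * q ^+ m != 0 := qpoch_neq0 (qq m.+1) (ltnSn m).
by field; rewrite qq qm.
Qed.

(** The condition becomes stronger as k grows: the term of index m + 1 for k is a
    bounded multiple of the term of index m for k + 1. The summability at z / q
    then follows from [shifted_term_diff]. *)
Lemma abs_summable_shifted_term (R : realType) (q z : R[i]) (h : nat -> R[i])
    (k : nat) :
  `|q| < 1 -> q != 0 -> abs_summable (shifted_term q z h k.+1) ->
  abs_summable (shifted_term q z h k) /\ abs_summable (shifted_term q (z / q) h k).
Proof.
move=> q1 q0 ss; have qq n := qpoch_q_neq0 n q1.
have diffE m := shifted_term_diff z h k m q0 qq.
have sk : abs_summable (shifted_term q z h k).
  apply: abs_summable_tail1.
  have p0 : 0 < 1 - `|q| by rewrite subr_gt0.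
  have C0 : 0 <= `|z| / (1 - `|q|) by rewrite divr_ge0 // ltW.
  apply: (abs_summable_le C0) ss => m.
  rewrite shifted_termS // normrM ler_wpM2r // normrN normrM normfV.
  have qm : 1 - `|q| <= `|1 - q ^+ m.+1|.
    apply: le_trans (lerB_normD _ _); rewrite normr1 normrN lerD2l lerN2.
    by rewrite normrX ler_iXnr // ltW.
  apply: ler_pM => //; rewrite ?invr_ge0 //.
    by rewrite normrM ler_piMr // normrX exprn_ile1 // ltW.
  by rewrite lef_pV2 ?posrE //; apply: lt_le_trans qm.
have sk' : abs_summable (shifted_term q (z / q) h k).
  apply: abs_summable_tail1.
  have -> : (fun m => shifted_term q (z / q) h k m.+1)
      = (fun m => shifted_term q z h k (1 + m) - z / q * shifted_term q z h k.+1 m).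
    by apply/funext => m; rewrite -diffE subKr.
  apply: abs_summableB; first exact: (abs_summable_shift 1 sk).
  by apply: (abs_summable_le (normr_ge0 (z / q))) ss => m; rewrite normrM.
by split.
Qed.

Lemma has_sum_hahn (R : realType) (q z al mu : R[i]) :
  `|q| < 1 -> q != 0 -> al != 0 -> (forall k, 1 - al * mu * z * q ^+ k != 0) ->
  abs_summable (shifted_term q z (fun n => hahn_psi al n mu q) 0) ->
  has_sum (shifted_term q z (fun n => hahn_psi al n mu q) 0)
    (qpochs_inf [:: mu * z; z] q / qpoch_inf (al * mu * z) q).
Proof.
move=> q1 q0 al0 cz; rewrite shifted_term0 => se.
apply: functional_eq_solution => //; first exact: hahn_coef0.
by apply: hahn_coef_functional => // n; exact: qpoch_q_neq0.
Qed.

(** The induction has to be on k for all z at once, since the step evaluates the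
    case k at z and at z / q. The nonvanishing conditions on z say that G has no
    pole at z, z/q, z/q^2 and so on. *)
Lemma has_sum_hahn_shifted (R : realType) (q al mu : R[i]) (k : nat) (z : R[i]) :
  `|q| < 1 -> q != 0 -> al != 0 -> mu != 0 -> z != 0 ->
  (forall i, qpoch (q / (al * mu * z)) q i != 0) ->
  (forall k, 1 - al * mu * z * q ^+ k != 0) ->
  abs_summable (shifted_term q z (fun n => hahn_psi al n mu q) k) ->
  has_sum (shifted_term q z (fun n => hahn_psi al n mu q) k)
    (qpochs_inf [:: mu * z; z] q / qpoch_inf (al * mu * z) q
     * phi32_sum q al^-1 (q / z) (q / (al * mu * z)) k).
Proof.
move=> q1 q0 al0 mu0; have qq n := qpoch_q_neq0 n q1.
set h := fun n => hahn_psi al n mu q.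
elim: k z => [|k IHk] z z0 gz cz ss.
  rewrite /phi32_sum big_ord1 !qpoch0 expr0 !mulr1 invr1 mulr1.
  by rewrite mulr1; apply: has_sum_hahn.
have diffE m := shifted_term_diff z h k m q0 qq.
have [sk sk'] := abs_summable_shifted_term q1 q0 ss.
have zq0 : z / q != 0 by rewrite mulf_neq0 ?invr_eq0.
have gzq : q / (al * mu * (z / q)) = q * (q / (al * mu * z)).
  by field; rewrite q0 z0 al0 mu0.
have wzq : q / (z / q) = q * (q / z) by field; rewrite q0 z0.
have g1 : 1 - q / (al * mu * z) != 0.
  by have := qpoch_neq0 (gz 1%N) (ltnSn 0); rewrite mulr1.
have gz' i : qpoch (q / (al * mu * (z / q))) q i != 0.
  by have := gz i.+1; rewrite qpochSl gzq mulf_eq0 negb_or => /andP[].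
have czq : al * mu * z - q != 0.
  by apply: contra_neq g1 => /subr0_eq <-; rewrite mulfV ?subrr ?mulf_neq0.
have cz1 : 1 - al * mu * (z / q) != 0.
  have -> : 1 - al * mu * (z / q) = - (al * mu * z - q) / q by field.
  by rewrite mulf_neq0 ?oppr_eq0 ?invr_eq0.
have cz' i : 1 - al * mu * (z / q) * q ^+ i != 0.
  case: i => [|i]; first by rewrite expr0 mulr1.
  have -> : al * mu * (z / q) * q ^+ i.+1 = al * mu * z * q ^+ i.
    by rewrite exprS; field.
  exact: cz.
have hk := IHk z z0 gz cz sk.
have hk' := IHk (z / q) zq0 gz' cz' sk'.
have [l hl] := abs_summable_cvg ss.
(* The term of index 0 of the difference vanishes. *)
have hd : has_sum
    (fun m => shifted_term q z h k m - shifted_term q (z / q) h k m)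
    (0 + z / q * l).
  have -> : 0 = \sum_(i < 1) (shifted_term q z h k i - shifted_term q (z / q) h k i).
    by rewrite big_ord1 /shifted_term !expr0 subrr.
  apply: has_sum_tail; have := has_sumZ (c := z / q) hl; congr has_sum.
  by apply/funext => m; rewrite diffE.
have := has_sum_unique hd (has_sumB hk hk'); rewrite add0r => lE.
suff -> : qpochs_inf [:: mu * z; z] q / qpoch_inf (al * mu * z) q *
   phi32_sum q al^-1 (q / z) (q / (al * mu * z)) k.+1 = l by [].
have -> : l = q / z * (z / q * l) by field; rewrite q0 z0.
rewrite lE (phi32_sum_rec _ _ _ q0 qq gz) gzq wzq /qpochs_inf !big_cons !big_nil !mulr1.
rewrite !(qpoch_infS (_ * (z / q)) q1) (qpoch_infS (z / q) q1).
have sc x : q * (x * (z / q)) = x * z by field.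
rewrite !sc (_ : q * (z / q) = z); last by field.
have [_ /(_ cz) C0] := qpoch_inf_cvg (al * mu * z) q1.
set C := qpoch_inf (al * mu * z) q in C0 *.
set A := qpoch_inf (mu * z) q; set B := qpoch_inf z q.
set P := phi32_sum _ _ _ _ _; set P' := phi32_sum _ _ _ _ _.
by field; rewrite q0 C0 z0 mu0 al0 czq -opprB oppr_eq0 czq.
Qed.

(** The exponents of q collapse to binom(m, 2), because
    binom(k+1, 2) + binom(k+m, 2) = binom(m, 2) + (k + m) k. Afterwards y and t
    occur in the sum over m only through y t. *)
Lemma psi_term_shifted_term (K : fieldType) (a b : seq K) (q x y t : K)
    (h : nat -> K) (k m : nat) :
  q != 0 -> (forall n, qpoch q q n != 0) -> qpochs b q k != 0 ->
  psi_term a b x y q (k + m) k * h (k + m)%N * (-1) ^+ (k + m)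
    * q ^+ 'C(k + m, 2) * (t ^+ (k + m) / qpoch q q (k + m))
  = qpochs a q k / qpochs (q :: b) q k * (x * t) ^+ k
    * shifted_term q (y * t) h k m.
Proof.
move=> q0 qq hbk; rewrite /shifted_term /psi_term /qbinom addKn.
have -> : q ^ ('C(k.+1, 2)%:Z - ((k + m) * k)%:Z)
    = q ^+ 'C(m, 2) / q ^+ 'C(k + m, 2).
  rewrite expfzDr // -exprnN -exprnP.
  apply: (canRL (mulfK _)); first by rewrite expf_neq0.
  rewrite mulrAC -exprD; apply: (canLR (mulfK _)); first by rewrite expf_neq0.
  have kk : ('C(k, 2) * 2 + k = k * k)%N.
    by elim: (k) => // i; rewrite binS bin1; lia.
  by rewrite -exprD; congr (_ ^+ _); rewrite binS bin1 bin2_addn; lia.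
rewrite /qpochs in hbk; rewrite /qpochs !big_cons !exprD !exprMn.
have sk : (-1) ^+ k * (-1) ^+ k = 1 :> K by rewrite -expr2 sqrr_sign.
have qC : q ^+ 'C(k + m, 2) != 0 by rewrite expf_neq0.
set A := \prod_(c <- a) _; set B := \prod_(c <- b) _ in hbk *.
transitivity (((-1) ^+ k * (-1) ^+ k) * (A * (-1) ^+ m * q ^+ 'C(m, 2)
    * (x ^+ k * t ^+ k * (y ^+ m * t ^+ m)) * h (k + m)%N
    / (B * qpoch q q k * qpoch q q m))).
  by field; rewrite qC hbk !qq.
by rewrite sk mul1r; field; rewrite hbk !qq.
Qed.

(** * Convergence of the right-hand side *)

(** Summability for every k means that the generating function E converges
    absolutely at all z / q^k, hence everywhere, in particular at the first pole
    1 / (al mu) of G. There the functional equation reads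
    0 = (1 - 1/al) (1 - 1/(al mu)) E(q / (al mu)), and evaluating the last factor
    by the product formula gives 0 = (1/al)_oo (1/(al mu))_oo, so that some factor
    1 - q^M / al or 1 - q^M / (al mu) vanishes. *)
Lemma abs_summable_all_shifts (R : realType) (q z al mu : R[i]) :
  `|q| < 1 -> q != 0 -> al != 0 -> mu != 0 -> z != 0 ->
  (forall k, abs_summable (shifted_term q z (fun n => hahn_psi al n mu q) k)) ->
  exists M, al = q ^+ M \/ al * mu = q ^+ M.
Proof.
move=> q1 q0 al0 mu0 z0 hs; set h := fun n => hahn_psi al n mu q.
have qq n := qpoch_q_neq0 n q1.
pose c := al * mu; have c0 : c != 0 by rewrite mulf_neq0.
have down k j z' : abs_summable (shifted_term q z' h (k + j)) ->
    abs_summable (shifted_term q (z' / q ^+ k) h j).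
  elim: k z' => [|k IHk] z'; first by rewrite expr0 divr1.
  move=> /(abs_summable_shifted_term q1 q0)[_ /IHk].
  by rewrite -mulrA -invfM -exprS.
have [k hk] : exists k, `|c^-1| <= `|z / q ^+ k|.
  have cz : 0 < `|c * z| by rewrite normr_gt0 mulf_neq0.
  have qlim := abs_summable_cvg0 (abs_summable_geo q1).
  have [k /(_ k (leqnn k))] := (cvgCP _ _).1 qlim _ cz.
  rewrite sub0r normrN => hk; exists k.
  rewrite normrM !normfV ler_pdivlMr ?normr_gt0 ?expf_neq0 //.
  by rewrite ler_pdivrMl ?normr_gt0 // -normrM ltW.
have := down k 0%N z; rewrite addn0 => /(_ (hs k)); rewrite shifted_term0 => sk.
have sc : abs_summable (fun n => hahn_coef q al mu n * (c^-1) ^+ n).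
  apply: (abs_summable_le ler01) sk => n.
  by rewrite mul1r !normrM ler_wpM2l // !normrX lerXn2r ?nnegrE.
have sc' : abs_summable (fun n => hahn_coef q al mu n * (c^-1 * q) ^+ n).
  apply: (abs_summable_le ler01) sc => n.
  by rewrite mul1r exprMn mulrA normrM ler_piMr // normrX exprn_ile1 // ltW.
have [E hE] := abs_summable_cvg sc.
have hE' : has_sum (fun n => hahn_coef q al mu n * (c^-1 * q) ^+ n)
   (qpochs_inf [:: mu * (c^-1 * q); c^-1 * q] q / qpoch_inf (al * mu * (c^-1 * q)) q).
  rewrite -shifted_term0; apply: has_sum_hahn => //; last by rewrite shifted_term0.
  by move=> i; rewrite -/c mulVKf // ; exact: (qpoch_neq0 (qq i.+1) (ltnSn i)).
have := functional_eq_sum (hahn_coef_functional mu q0 al0 qq) hE hE'.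
rewrite -/c mulfV // subrr mul0r mulVKf // /qpochs_inf !big_cons big_nil mulr1.
have muc : mu * c^-1 = al^-1 by rewrite /c invfM mulrCA mulfV ?mulr1.
rewrite (mulrA mu) muc => /esym/eqP.
rewrite (mulrC al^-1 q) (mulrC c^-1 q) !mulf_eq0 invr_eq0.
have -> : (qpoch_inf q q == 0) = false.
  apply/negbTE/(qpoch_inf_cvg q q1).2 => i.
  exact: (qpoch_neq0 (qq i.+1) (ltnSn i)).
have expE x i : x != 0 -> x^-1 * q ^+ i = 1 -> x = q ^+ i.
  by move=> x0 h1; rewrite -[RHS](mulVKf x0) h1 mulr1.
have zeroE x : x != 0 -> (1 - x^-1) * qpoch_inf (q * x^-1) q = 0 ->
    exists i, x = q ^+ i.
  rewrite -qpoch_infS // => x0 /(qpoch_inf_eq0 q1)[i /(expE _ _ x0) xE].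
  by exists i.
rewrite orbF => H.
suff [/eqP/(zeroE _ al0)[i ai]|/eqP/(zeroE _ c0)[i ci]] :
   ((1 - al^-1) * qpoch_inf (q * al^-1) q == 0)
   \/ ((1 - c^-1) * qpoch_inf (q * c^-1) q == 0).
- by exists i; left.
- by exists i; right.
rewrite !mulf_eq0; case/orP: H => /orP[] H; [left|right|left|right];
  by rewrite H ?orbT.
Qed.

(** The sum has at most M + 1 nonzero terms because of the factor (q^(-M))_i, and
    q^(ki) (q^(-k))_i is a product of i differences q^k - q^l. *)
Lemma phi32_sum_bounded (R : realType) (q w g : R[i]) (M : nat) :
  `|q| < 1 -> q != 0 ->
  exists C, forall k, `|q ^+ (k * M) * phi32_sum q (q ^- M) w g k| <= C.
Proof.
move=> q1 q0.
pose K i := qpoch w q i * qpoch (q ^- M) q i / (qpoch g q i * qpoch q q i) * q ^+ i.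
exists (\sum_(i < M.+1) 2 ^+ i * `|K i|) => k.
(* The sum may be cut at k, where (q^(-k))_i vanishes, or at M, where (q^(-M))_i
   does. *)
have -> : phi32_sum q (q ^- M) w g k = \sum_(i < M.+1) qpoch (q ^- k) q i * K i.
  have E n : (k <= n)%N ->
      phi32_sum q (q ^- M) w g k = \sum_(i < n.+1) qpoch (q ^- k) q i * K i.
    move=> kn; rewrite /phi32_sum (big_ord_widen n.+1 (fun i =>
      qpoch (q ^- k) q i * qpoch w q i * qpoch (q ^- M) q i
      / (qpoch g q i * qpoch q q i) * q ^+ i)) //.
    rewrite big_mkcond; apply: eq_bigr => i _; case: ltnP => ki.
      by rewrite /K !mulrA.
    by rewrite qpoch_expN_eq0 ?mul0r.
  have E' n : (M <= n)%N ->
      \sum_(i < M.+1) qpoch (q ^- k) q i * K i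
      = \sum_(i < n.+1) qpoch (q ^- k) q i * K i.
    move=> Mn; rewrite (big_ord_widen n.+1 (fun i => qpoch (q ^- k) q i * K i)) //.
    rewrite big_mkcond; apply: eq_bigr => i _; case: ltnP => // Mi.
    by rewrite /K (qpoch_expN_eq0 q0 Mi) !(mulr0, mul0r).
  by rewrite (E _ (leq_addr M k)) (E' _ (leq_addl k M)).
rewrite mulr_sumr; apply: le_trans (ler_norm_sum _ _ _) _.
apply: ler_sum => -[i /= iM] _; rewrite mulrA normrM ler_wpM2r //.
rewrite -(subnK (ltnSE iM)) mulnDr exprD -mulrA normrM.
have qle1 n : `|q ^+ n| <= 1 by rewrite normrX exprn_ile1 // ltW.
rewrite -[X in _ <= X]mul1r ler_pM // exprM.
have -> : q ^+ k ^+ i * qpoch (q ^- k) q i = \prod_(l < i) (q ^+ k - q ^+ l).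
  have -> : q ^+ k ^+ i = \prod_(l < i) q ^+ k by rewrite prodr_const card_ord.
  rewrite -big_split /=; apply: eq_bigr => l _.
  by rewrite mulrBr mulr1 mulrA mulfV ?mul1r // expf_neq0.
rewrite normr_prod -[X in 2 ^+ X](card_ord i) -prodr_const.
apply: ler_prod => l _; rewrite normr_ge0 /=.
by apply: le_trans (ler_normB _ _) _; rewrite mulr2n lerD.
Qed.

(** For al = q^M only the summands with j <= M survive in the Hahn polynomial, and
    after multiplication by q^(nM) the summand j carries q^(n(M-j)), so that only
    j = M contributes to the limit. *)
Lemma hahn_psi_scaled_lim (R : realType) (q mu : R[i]) (M : nat) :
  `|q| < 1 -> q != 0 ->
  (fun k => q ^+ ((M + k) * M) * hahn_psi (q ^+ M) (M + k) mu q) @ \oo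
    --> q ^+ (M * M) * mu ^+ M.
Proof.
move=> q1 q0; have qq n := qpoch_q_neq0 n q1.
pose t n j := q ^ (j%:Z * (j%:Z - n%:Z)) * qbinom q n j
    * qpoch (q ^+ M * q ^ (1 - j%:Z)) q j * mu ^+ j.
have t0 n j : (M < j)%N -> t n j = 0.
  move=> Mj; rewrite /t (_ : qpoch _ q j = 0) ?mulr0 ?mul0r //.
  have jM : (j - M.+1 < j)%N by lia.
  apply/eqP/prodf_eq0; exists (Ordinal jM) => //=.
  rewrite !exprnP -!expfzDr //.
  have -> : M%:Z + (1 - j%:Z) + (j - M.+1)%N%:Z = 0 by lia.
  by rewrite expr0z subrr.
pose F j k := q ^+ (j * j) * q ^+ (M - j) ^+ (M + k) * qbinom q (M + k) j
    * qpoch (q ^+ M * q ^ (1 - j%:Z)) q j * mu ^+ j.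
pose L j := q ^+ (j * j) * (M <= j)%:R / qpoch q q j
    * qpoch (q ^+ M * q ^ (1 - j%:Z)) q j * mu ^+ j.
have -> : (fun k => q ^+ ((M + k) * M) * hahn_psi (q ^+ M) (M + k) mu q)
    = (fun k => \sum_(j < M.+1) F j k).
  apply/funext => k; rewrite /hahn_psi mulr_sumr.
  rewrite (big_ord_widen (M + k).+1 (fun j => F j k)) ?ltnS ?leq_addr //.
  rewrite [RHS]big_mkcond; apply: eq_bigr => -[j /= jk] _; case: ltnP => jM; last first.
    by have := t0 (M + k)%N j jM; rewrite /t => ->; rewrite mulr0.
  rewrite /F !mulrA; congr (_ * _ * _ * _).
  rewrite -exprM -exprD !exprnP -expfzDr //; congr (q ^ _ * _).
  by rewrite ltnS in jM; rewrite -(subnK jM) addnK; lia.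
have -> : q ^+ (M * M) * mu ^+ M = \sum_(j < M.+1) L j.
  rewrite big_ord_recr big1 => [|j _]; last first.
    by rewrite /L /= leqNgt ltn_ord mulr0 !mul0r.
  rewrite /L leqnn mulr1 /= add0r; congr (_ * _).
  have -> : q ^+ M * q ^ (1 - M%:Z) = q.
    by rewrite exprnP -expfzDr // addrC subrK expr1z.
  by rewrite divfK.
apply: cvgC_bigsum => j; rewrite ltnS => jM.
have [hP P0] := qpoch_inf_cvg q q1.
rewrite /F /L; apply: cvgCM; last exact: cvgC_cst.
apply: cvgCM; last exact: cvgC_cst.
have -> : q ^+ (j * j) * (M <= j)%:R / qpoch q q j
   = q ^+ (j * j) * (M <= j)%:R * (qpoch_inf q q / (qpoch q q j * qpoch_inf q q)).
  rewrite invfM [qpoch_inf q q * _]mulrCA mulfV ?mulr1 ?P0 // => i.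
  by have := qpoch_neq0 (qq i.+1) (ltnSn i).
have hq1 : (fun k => qpoch q q (M + k)) @ \oo --> qpoch_inf q q.
  exact: cvgC_addl hP.
have hq2 : (fun k => (qpoch q q (M + k - j))^-1) @ \oo --> (qpoch_inf q q)^-1.
  apply: cvgCV.
    by apply: P0 => i; have := qpoch_neq0 (qq i.+1) (ltnSn i).
  have -> : (fun k => qpoch q q (M + k - j)) = (fun k => qpoch q q (M - j + k)).
    by apply/funext => k; rewrite addnBAC.
  exact: cvgC_addl hP.
apply: cvgCM; last first.
  rewrite /qbinom; apply: cvgCM; first exact: hq1.
  under eq_fun do rewrite invfM.
  by rewrite invfM; apply: cvgCM; [exact: cvgC_cst|exact: hq2].
apply: cvgCM; first exact: cvgC_cst.
apply: (@cvgC_addl _ M (fun n => q ^+ (M - j) ^+ n)).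
move: jM; rewrite leq_eqVlt => /orP[/eqP ->|jM].
  rewrite subnn leqnn expr0.
  by under eq_fun do rewrite expr1n; exact: cvgC_cst.
rewrite leqNgt jM; apply: abs_summable_cvg0; apply: abs_summable_geo.
by rewrite normrX exprn_ilt1 // -lt0n subn_gt0.
Qed.

Lemma phi32_sum_le_hahn_psi (R : realType) (q w g mu : R[i]) (M : nat) :
  `|q| < 1 -> q != 0 -> mu != 0 ->
  exists C N, 0 <= C /\ forall k, (N <= k)%N ->
    `|phi32_sum q (q ^- M) w g k| <= C * `|hahn_psi (q ^+ M) k mu q|.
Proof.
move=> q1 q0 mu0; have [B hB] := phi32_sum_bounded w g M q1 q0.
set L := q ^+ (M * M) * mu ^+ M.
have L0 : 0 < `|L| by rewrite normr_gt0 mulf_neq0 // expf_neq0.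
have L2 : 0 < `|L| / 2 by rewrite divr_gt0.
have [K hK] := (cvgCP _ _).1 (@hahn_psi_scaled_lim _ q mu M q1 q0) _ L2.
have B0 : 0 <= B by apply: le_trans (hB 0%N).
exists (B / (`|L| / 2)), (M + K)%N; split; first by rewrite divr_ge0 // ltW.
move=> n Kn; have Mn : (M <= n)%N := leq_trans (leq_addr _ _) Kn.
have qn : 0 < `|q ^+ (n * M)| by rewrite normr_gt0 expf_neq0.
have := hK (n - M)%N; rewrite leq_subRL // subnKC // -/L => /(_ Kn) Lh.
have {}Lh : `|L| / 2 <= `|q ^+ (n * M) * hahn_psi (q ^+ M) n mu q|.
  rewrite -(lerD2l (`|L| / 2)) -splitr.
  set x := (X in _ + `|X|) in Lh *.
  rewrite -{1}(subrK x L); apply: le_trans (ler_normD _ _) _.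
  by rewrite lerD2r ltW.
rewrite -(ler_pM2l qn) -normrM; apply: le_trans (hB n) _.
rewrite mulrCA -normrM -mulrA ler_peMr //.
by rewrite mulrC ler_pdivlMr ?mul1r.
Qed.

(** The two cases correspond to each other under the symmetry of [hahn_psi_sym]
    and [phi32_sum_sym], which multiplies both sides by the same power of mu. *)
Lemma phi32_sum_dominated (R : realType) (q z al mu : R[i]) (M : nat) :
  `|q| < 1 -> q != 0 -> al != 0 -> mu != 0 -> z != 0 ->
  (forall i, qpoch (q / (al * mu * z)) q i != 0) ->
  al = q ^+ M \/ al * mu = q ^+ M ->
  exists C N, 0 <= C /\ forall k, (N <= k)%N ->
    `|phi32_sum q al^-1 (q / z) (q / (al * mu * z)) k|
    <= C * `|hahn_psi al k mu q|.
Proof.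
move=> q1 q0 al0 mu0 z0 gg [alE|cE].
  have := @phi32_sum_le_hahn_psi R q (q / z) (q / (al * mu * z)) mu M q1 q0 mu0.
  by rewrite -alE.
set w := q / z; set g := q / (al * mu * z) in gg *.
have mu0' : mu^-1 != 0 by rewrite invr_eq0.
have [C [N [C0 hC]]] := @phi32_sum_le_hahn_psi R q (g / al^-1) g _ M q1 q0 mu0'.
have qq n := qpoch_q_neq0 n q1.
exists C, N; split=> // k /hC {}hC.
have al0' : al^-1 != 0 by rewrite invr_eq0.
have w0 : w != 0 by rewrite mulf_neq0 ?invr_eq0.
have g0 : g != 0 by rewrite mulf_neq0 ?invr_eq0 ?mulf_neq0.
rewrite (phi32_sum_sym k q0 al0' w0 g0 qq gg) (hahn_psi_sym k q0 al0 mu0 qq).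
have -> : al^-1 * w / g = mu by rewrite /w /g; field; rewrite q0 z0 al0 mu0.
have -> : g / w = q ^- M by rewrite /w /g -cE; field; rewrite q0 z0 al0 mu0.
by rewrite !normrM mulrCA ler_wpM2l // cE.
Qed.

(** * The bilinear generating function *)

Theorem theorem10 (R : realType) (r : nat)
    (a : r.+1.-tuple R[i]) (b : r.-tuple R[i])
    (q x y t alpha mu : R[i])
    (hq0 : q != 0) (hq1 : `|q| < 1)
    (hy : y != 0) (ht : t != 0) (halpha : alpha != 0) (hmu : mu != 0)
    (hb : forall k : nat, qpochs b q k != 0)
    (hden : forall i : nat, qpoch (q / (alpha * mu * y * t)) q i != 0)
    (hlt1 : `|alpha * mu * y * t| < 1)
    (habs : cvgn (series (fun n : nat =>
       \sum_(k < n.+1)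
         `|psi_term a b x y q n k * hahn_psi alpha n mu q
           * (-1) ^+ n * q ^+ 'C(n, 2) * (t ^+ n / qpoch q q n)|))) :
  let lhs := fun n : nat =>
    psi a b n x y q * hahn_psi alpha n mu q
    * (-1) ^+ n * q ^+ 'C(n, 2) * (t ^+ n / qpoch q q n) in
  let rhs := fun j : nat =>
    qpochs a q j / qpochs (q :: b) q j * (x * t) ^+ j
    * phi32 (q ^- j) (q / (y * t)) alpha^-1
            (q / (alpha * mu * y * t)) 0 q q in
  [/\ cvgn (series lhs), cvgn (series rhs) &
      limn (series lhs)
      = qpochs_inf [:: mu * y * t; y * t] q / qpoch_inf (alpha * mu * y * t) q
        * limn (series rhs)].
Proof.
move=> lhs rhs; pose z := y * t.
have qq n := qpoch_q_neq0 n hq1.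
have z0 : z != 0 by rewrite mulf_neq0.
have czE : alpha * mu * y * t = alpha * mu * z by rewrite -[LHS]mulrA.
have mzE : mu * y * t = mu * z by rewrite -[LHS]mulrA.
rewrite czE in hden hlt1.
pose h n := hahn_psi alpha n mu q.
pose D k := qpochs a q k / qpochs (q :: b) q k * (x * t) ^+ k.
pose F n k := psi_term a b x y q n k * h n
           * (-1) ^+ n * q ^+ 'C(n, 2) * (t ^+ n / qpoch q q n).
pose T n k := if (k <= n)%N then F n k else 0.
have FE k m : F (k + m)%N k = D k * shifted_term q z h k m.
  exact: psi_term_shifted_term.
have M0 n : 0 <= \sum_(k < n.+1) `|F n k| by rewrite sumr_ge0.
have sM : abs_summable (fun n => \sum_(k < n.+1) `|F n k|).
  exact: ge0_cvg_abs_summable.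
have TF n : \sum_(k < n.+1) T n k = lhs n.
  rewrite /lhs /psi !mulr_suml; apply: eq_bigr => k _.
  by rewrite /T -ltnS ltn_ord.
have sM' : abs_summable (fun n => \sum_(k < n.+1) `|T n k|).
  move: sM; congr abs_summable; apply/funext => n; apply: eq_bigr => k _.
  by rewrite /T -ltnS ltn_ord.
pose G := qpochs_inf [:: mu * z; z] q / qpoch_inf (alpha * mu * z) q.
have cz i : 1 - alpha * mu * z * q ^+ i != 0.
  rewrite subr_eq0; apply/eqP => /(congr1 (fun u => `|u|)) /eqP.
  rewrite normr1 normrM eq_sym lt_eqF // normrX.
  by apply: le_lt_trans hlt1; rewrite ler_piMr // exprn_ile1 // ltW.
have rhsE k : rhs k = D k * phi32_sum q alpha^-1 (q / z) (q / (alpha * mu * z)) k.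
  by rewrite /rhs phi32_terminating // czE.
have sumD k : D k != 0 -> abs_summable (shifted_term q z h k).
  move=> Dk; have D0 : 0 <= `|(D k)^-1| by [].
  apply: (abs_summable_le D0) (abs_summable_shift k sM) => m.
  rewrite [X in _ <= _ * X]ger0_norm // normfV ler_pdivlMl ?normr_gt0 // -normrM -FE.
  have km : (k < (k + m).+1)%N by rewrite ltnS leq_addr.
  by rewrite (bigD1 (Ordinal km)) //= lerDl sumr_ge0.
have hT k : has_sum (fun n => T n k) (G * rhs k).
  have -> : G * rhs k = \sum_(i < k) T i k + G * rhs k.
    by rewrite big1 ?add0r // => i _; rewrite /T leqNgt ltn_ord.
  apply: has_sum_tail.
  have -> : (fun n => T (k + n)%N k) = (fun m => D k * shifted_term q z h k m).
    by apply/funext => m; rewrite /T leq_addr FE.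
  rewrite rhsE mulrCA; have [->|Dk] := eqVneq (D k) 0.
    (* Nothing is known about the inner sum here, but the whole column is 0. *)
    rewrite mul0r.
    have := has_sum_finite (f := fun m => 0 * shifted_term q z h k m) (N := 0).
    by rewrite big_ord0; apply=> n _; rewrite mul0r.
  by apply/has_sumZ/has_sum_hahn_shifted => //; exact: sumD.
have T0 n k : (n < k)%N -> T n k = 0 by move=> nk; rewrite /T leqNgt nk.
have [l hl hr] := triangular_sum_exchange T0 sM' hT.
have {}hl : has_sum lhs l.
  by move: hl; congr has_sum; apply/funext => n; exact: TF.
have [l' hr'] : exists l', has_sum rhs l'.
  have [[K DK]|Dneq0] := pselect (exists K, D K = 0).
    exists (\sum_(i < K) rhs i); apply: has_sum_finite => n Kn.
    (* A factor of D K that vanishes divides every later D n. *)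
    have Dn : D n = 0.
      move: DK => /eqP; rewrite /D !mulf_eq0 invr_eq0 -orbA => /or3P[/eqP aK|bK|xK].
      - by rewrite (qpochs_eq0_leq Kn aK) !mul0r.
      - move: bK; rewrite /qpochs big_cons mulf_eq0 (negbTE (qq K)) /=.
        by rewrite -[X in X == 0]/(qpochs b q K) (negbTE (hb K)).
      - by move: xK; rewrite -(subnKC Kn) exprD => /eqP ->; rewrite mul0r mulr0.
    by rewrite rhsE Dn mul0r.
  have hs k : abs_summable (shifted_term q z h k).
    by apply: sumD => //; apply/eqP => Dk; apply: Dneq0; exists k.
  have [M aM] := abs_summable_all_shifts hq1 hq0 halpha hmu z0 hs.
  have [C [N [C0' hC]]] := phi32_sum_dominated hq1 hq0 halpha hmu z0 hden aM.
  have sr : abs_summable (fun k => rhs (N + k)%N).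
    apply: (abs_summable_le C0') (abs_summable_shift N sM) => k.
    set n := (N + k)%N; rewrite rhsE normrM.
    have {}hC := hC n (leq_addr _ _).
    apply: le_trans (ler_wpM2l (normr_ge0 (D n)) hC) _.
    rewrite mulrCA ler_wpM2l // -normrM [X in _ <= X]ger0_norm //.
    have := FE n 0%N.
    rewrite /shifted_term addn0 qpoch0 bin0n !expr0 !mul1r invr1 mulr1.
    by move=> <-; rewrite big_ord_recr /= lerDr sumr_ge0.
  have [s hs'] := abs_summable_cvg sr.
  by exists (\sum_(i < N) rhs i + s); apply: has_sum_tail.
have lE : l = G * l' := has_sum_unique hr (has_sumZ hr').
have hl' : series lhs @ \oo --> l by apply/has_sumP.
have hr'' : series rhs @ \oo --> l' by apply/has_sumP.
split; [exact: cvgP hl'|exact: cvgP hr''|].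
have -> : limn (series lhs) = l by exact: cvg_lim hl'.
have -> : limn (series rhs) = l' by exact: cvg_lim hr''.
by rewrite lE mzE czE.
Qed.
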